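(* Let $V$ be a unital JB-algebra. Then $\mathrm{Aut}(V)\subset\mathrm{Str}(V)$ is an algebraic subgroup of $GL(V)$; in particular it is an embedded Banach-Lie subgroup, and if $\mathcal B=\{X\in B(V):\|X\|<\frac{\pi}{2}\}$, then $$\exp(\mathcal B\cap\mathrm{Lie}(\mathrm{Aut}(V)))=\exp(\mathcal B)\cap\mathrm{Aut}(V).$$ Moreover its Banach-Lie algebra is $\mathrm{Lie}(\mathrm{Aut}(V))=\mathrm{Der}(V)$, the space of bounded derivations of $V$, and it is contained in $\mathrm{Lie}(\mathrm{Str}(V))$.
   Context: A (unital) JB-algebra is a real Jordan algebra $(V,\circ)$ with unit $1$ (the product is bilinear, commutative and $x^2\circ(x\circ y)=x\circ(x^2\circ y)$) with a complete norm such that $\|x\circ y\|\le\|x\|\|y\|$, $\|x^2\|=\|x\|^2$, $\|x^2\|\le\|x^2+y^2\|$; it may be infinite dimensional. $B(V)$ is the algebra of bounded linear operators on $V$ with the operator norm and $GL(V)$ its group of invertible elements, a Banach-Lie group with Lie algebra $B(V)$ and the usual exponential. $L_xy=x\circ y$, $U_x=2L_x^2-L_{x^2}$. The structure group $\mathrm{Str}(V)$ is the set of $g\in GL(V)$ for which there is $g^*\in GL(V)$ with $U_{gx}=gU_xg^*$ for all $x\in V$. $\mathrm{Aut}(V)$ is the group of $k\in GL(V)$ with $k(a\circ b)=k(a)\circ k(b)$ for all $a,b\in V$. $\mathrm{Der}(V)$ is the set of $D\in B(V)$ with $D(x\circ y)=Dx\circ y+x\circ Dy$ for all $x,y\in V$.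 A subgroup $G\subset GL(V)$ is algebraic if there is a family of (continuous) polynomial maps $P_i:B(V)\times B(V)\to B(V)$ such that $G=\{g\in GL(V): P_i(g,g^{-1})=0\ \forall i\}$. An embedded Banach-Lie subgroup of $GL(V)$ is a closed subgroup $G$ that is an embedded submanifold and a Banach-Lie group with the induced (norm) topology; its Lie algebra is $\mathrm{Lie}(G)=T_{\mathrm{Id}}G=\{H\in B(V): e^{tH}\in G\ \forall t\in\mathbb R\}$. *)

(* Defs.v *)
From HB Require Import structures.
From mathcomp Require Import all_boot all_order all_algebra.
From mathcomp Require Import all_classical all_reals all_analysis.
Set Implicit Arguments.
Unset Strict Implicit.
Unset Printing Implicit Defensive.
Import Order.TTheory GRing.Theory Num.Theory.
Import numFieldNormedType.Exports.
Local Open Scope classical_set_scope.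
Local Open Scope ring_scope.

Definition bounded_operator (R : realType) (E F : normedModType R)
    (f : E -> F) : Prop :=
  linear f /\ exists M : R, forall x, `|f x| <= M * `|x|.

Definition bop_pred (R : realType) (E F : normedModType R) : {pred E -> F} :=
  fun f => `[< bounded_operator f >].

(* The space B(E, F) of bounded linear operators, normed below by the operator
   norm. *)
Record bop (R : realType) (E F : normedModType R) := Bop {
  bop_fun :> E -> F;
  bop_funP : bop_fun \in @bop_pred R E F }.

Section BoundedOperators.
Context {R : realType} {E F : normedModType R}.

HB.instance Definition _ := [isSub for @bop_fun R E F].
HB.instance Definition _ := [Choice of bop E F by <:].

Definition mkbop (f : E -> F) (fP : bounded_operator f) : bop E F :=
  Bop (introT (asboolP _) fP).

Lemma bopP (f : bop E F) : bounded_operator f.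
Proof. exact/asboolP/bop_funP. Qed.

Lemma bop_eq (f g : bop E F) : (forall x, f x = g x) -> f = g.
Proof. by move=> fg; apply/val_inj/funext. Qed.

Lemma bop_linear (f : bop E F) : linear f.
Proof. by case: (bopP f). Qed.

HB.instance Definition _ (f : bop E F) :=
  GRing.isLinear.Build R E F *:%R f (bop_linear f).

Lemma bop_submod_closed : submod_closed (@bop_pred R E F).
Proof.
split=> [|a f g /asboolP[lf [M hM]] /asboolP[lg [N hN]]]; apply/asboolP.
  split=> [a x y|]; first by rewrite /= scaler0 addr0.
  by exists 0 => x; rewrite normr0 mul0r.
split=> [b x y|].
  rewrite !fctE lf lg !scalerDr !scalerA -!addrA; congr (_ + _).
    by rewrite mulrC.
  by rewrite addrCA.
exists (`|a| * M + N) => x; rewrite fctE mulrDl.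
rewrite (le_trans (ler_normD _ _))// lerD// normrZ -mulrA.
by rewrite ler_wpM2l.
Qed.

HB.instance Definition _ :=
  GRing.isSubmodClosed.Build R (E -> F) (@bop_pred R E F) bop_submod_closed.
HB.instance Definition _ := [SubChoice_isSubLmodule of bop E F by <:].

Definition opnorm (f : bop E F) : R :=
  sup [set `|f x| | x in [set x : E | `|x| <= 1]].

Lemma opnorm_has_sup (f : bop E F) :
  has_sup [set `|f x| | x in [set x : E | `|x| <= 1]].
Proof.
split; first by exists `|f 0|, 0 => //=; rewrite normr0.
have [_ [M hM]] := bopP f; exists `|M| => _ [x /= x1 <-].
apply: le_trans (hM x) _; apply: le_trans (ler_wpM2r _ (ler_norm M)) _ => //.
by rewrite ler_piMr.
Qed.

Lemma le_opnorm_unit (f : bop E F) x : `|x| <= 1 -> `|f x| <= opnorm f.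
Proof.
by move=> x1; apply: sup_upper_bound; [exact: opnorm_has_sup|exists x].
Qed.

Lemma opnorm_ge0 (f : bop E F) : 0 <= opnorm f.
Proof. by have := @le_opnorm_unit f 0; rewrite normr0 linear0 normr0; exact. Qed.

Lemma le_opnorm (f : bop E F) x : `|f x| <= opnorm f * `|x|.
Proof.
have [->|x0] := eqVneq x 0; first by rewrite linear0 !normr0 mulr0.
have nx : 0 < `|x| by rewrite normr_gt0.
rewrite -ler_pdivrMr// mulrC.
rewrite (_ : _ * _ = `|f (`|x|^-1 *: x)|).
  by apply: le_opnorm_unit; rewrite normrZ normfV normr_id mulVf// gt_eqF.
by rewrite linearZ normrZ normfV normr_id.
Qed.

Lemma opnorm_le (f : bop E F) (M : R) :
  (forall x, `|x| <= 1 -> `|f x| <= M) -> opnorm f <= M.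
Proof.
move=> hM; apply: ge_sup; first by have [] := opnorm_has_sup f.
by move=> _ [x /= x1 <-]; exact: hM.
Qed.

Lemma opnormD (f g : bop E F) : opnorm (f + g) <= opnorm f + opnorm g.
Proof.
apply: opnorm_le => x x1; apply: le_trans (ler_normD _ _) _.
by rewrite lerD// le_opnorm_unit.
Qed.

Lemma opnormZ (l : R) (f : bop E F) : opnorm (l *: f) = `|l| * opnorm f.
Proof.
have le l' (g : bop E F) : opnorm (l' *: g) <= `|l'| * opnorm g.
  apply: opnorm_le => x x1; rewrite [X in `|X|](_ : _ = l' *: g x)// normrZ.
  by rewrite ler_wpM2l// le_opnorm_unit.
have [->|l0] := eqVneq l 0.
  apply/eqP; rewrite eq_le le/=.
  by rewrite normr0 mul0r opnorm_ge0.
apply/eqP; rewrite eq_le le/=.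
have := le l^-1 (l *: f); rewrite scalerA mulVf// scale1r normfV.
by rewrite mulrC ler_pdivlMr ?normr_gt0// mulrC.
Qed.

Lemma opnorm_eq0 (f : bop E F) : opnorm f = 0 -> f = 0.
Proof.
move=> f0; apply: bop_eq => x.
by have := le_opnorm f x; rewrite f0 mul0r normr_le0 => /eqP.
Qed.

HB.instance Definition _ :=
  @Lmodule_isNormed.Build R (bop E F) opnorm opnormD opnormZ opnorm_eq0.

End BoundedOperators.

Section OperatorRing.
Context {R : realType} {V : normedModType R}.
Implicit Types f g h : bop V V.

Lemma bop_id_subproof : bounded_operator (fun x : V => x).
Proof. by split=> [a x y //|]; exists 1 => x; rewrite mul1r. Qed.

Lemma bop_comp_subproof f g : bounded_operator (fun x => f (g x)).
Proof.
split=> [a x y|]; first by rewrite !linearP.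
exists (opnorm f * opnorm g) => x; apply: le_trans (le_opnorm f _) _.
by rewrite -mulrA ler_wpM2l ?opnorm_ge0// le_opnorm.
Qed.

Definition bop_id : bop V V := mkbop bop_id_subproof.
Definition bop_comp f g : bop V V := mkbop (bop_comp_subproof f g).

Fact bop_compA : associative bop_comp.
Proof. by move=> f g h; apply: bop_eq. Qed.
Fact bop_comp1l : left_id bop_id bop_comp.
Proof. by move=> f; apply: bop_eq. Qed.
Fact bop_comp1r : right_id bop_id bop_comp.
Proof. by move=> f; apply: bop_eq. Qed.
Fact bop_compDl : left_distributive bop_comp +%R.
Proof. by move=> f g h; apply: bop_eq. Qed.
Fact bop_compDr : right_distributive bop_comp +%R.
Proof. by move=> f g h; apply: bop_eq => x; exact: linearD. Qed.

(* B(V): the product is composition; the ring may be trivial (V = 0). *)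
HB.instance Definition _ := GRing.Zmodule_isPzRing.Build (bop V V)
  bop_compA bop_comp1l bop_comp1r bop_compDl bop_compDr.

End OperatorRing.

Section Calculus.
Context {R : realType}.

(* f is of class C^n (in the sense of Frechet) at the points of U, which is
   meant to be open. *)
Fixpoint Cn_on (n : nat) (E F : normedModType R) (U : set E) (f : E -> F)
    {struct n} : Prop :=
  match n with
  | 0 => forall x, U x -> {for x, continuous f}
  | m.+1 => exists Df : E -> bop E F,
      (forall x, U x -> is_diff x f (Df x)) /\ Cn_on m U Df
  end.

Definition smooth_on (E F : normedModType R) (U : set E) (f : E -> F) : Prop :=
  open U /\ forall n, Cn_on n U f.

Definition bounded_multilinear (E F : normedModType R) (k : nat)
    (A : ('I_k -> E) -> F) : Prop :=
  (forall (x : 'I_k -> E) (i : 'I_k),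
     linear (fun u : E => A (fun j => if j == i then u else x j))) /\
  exists M : R, forall x, `|A x| <= M * \prod_(i < k) `|x i|.

Definition continuous_polynomial (E F : normedModType R) (P : E -> F) : Prop :=
  exists (d : nat) (A : forall k : nat, ('I_k -> E) -> F),
    (forall k, bounded_multilinear (A k)) /\
    forall x, P x = \sum_(k < d.+1) A k (fun=> x).

Definition tangent_space (E : normedModType R) (G : set E) (g : E) : set E :=
  [set H | exists e : R, 0 < e /\ exists c : R^o -> E,
     [/\ smooth_on (ball (0 : R^o) e) c,
         forall t, ball (0 : R^o) e t -> G (c t),
         c 0 = g &
         is_derive (0 : R^o) (1 : R^o) c H]].

End Calculus.

Section Submanifolds.
Context {R : realType}.

(* A chart of E, from the open set sc_dom onto the open set sc_cod of E, that
   takes G to the range of j. When j is a linear isometry from a Banach space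
   M, its range is an arbitrary closed subspace of E, which need not be
   complemented. *)
Record slice_chart (E M : normedModType R) (j : bop M E) (G : set E) :=
  SliceChart {
    sc_dom : set E;
    sc_cod : set E;
    sc_fun : E -> E;
    sc_inv : E -> E;
    sc_fun_smooth : smooth_on sc_dom sc_fun;
    sc_inv_smooth : smooth_on sc_cod sc_inv;
    sc_fun_dom : forall x, sc_dom x -> sc_cod (sc_fun x);
    sc_inv_cod : forall y, sc_cod y -> sc_dom (sc_inv y);
    sc_funK : forall x, sc_dom x -> sc_inv (sc_fun x) = x;
    sc_invK : forall y, sc_cod y -> sc_fun (sc_inv y) = y;
    sc_slice : forall x, sc_dom x -> (G x <-> range j (sc_fun x)) }.

Definition embedded_submanifold (E M : normedModType R) (j : bop M E)
    (G : set E) : Prop :=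
  forall g, G g -> exists c : slice_chart j G, sc_dom c g.

(* The chart of G with values in M, and the parametrization of G, that a slice
   chart induces. *)
Definition sc_coord (E M : normedModType R) (j : bop M E) (G : set E)
    (c : slice_chart j G) (x : E) : M :=
  xget 0 [set h | j h = sc_fun c x].
Definition sc_param (E M : normedModType R) (j : bop M E) (G : set E)
    (c : slice_chart j G) (h : M) : E :=
  sc_inv c (j h).

End Submanifolds.

Section OperatorGroups.
Context {R : realType} {V : normedModType R}.
Notation BV := (bop V V).

Definition GL : set BV := [set g | exists h : BV, g * h = 1 /\ h * g = 1].

Definition opinv (g : BV) : BV := xget 0 [set h | g * h = 1 /\ h * g = 1].

Definition opexp (X : BV) : BV :=
  limn (series (fun n : nat => (n`!%:R : R)^-1 *: X ^+ n)).

Definition GL_subgroup (G : set BV) : Prop :=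
  [/\ G `<=` GL, G 1,
      (forall g h, G g -> G h -> G (g * h)) &
      (forall g, G g -> G (opinv g))].

Definition algebraic_subgroup (G : set BV) : Prop :=
  GL_subgroup G /\
  exists P : set (BV * BV -> BV),
    (forall p, P p -> continuous_polynomial p) /\
    G = [set g | GL g /\ forall p, P p -> p (g, opinv g) = 0].

(* Multiplication and inversion of G are smooth for the manifold structure on
   G given by the slice charts. *)
Definition smooth_group_law (M : normedModType R) (j : bop M BV)
    (G : set BV) : Prop :=
  (forall c1 c2 c3 : slice_chart j G,
     let mul (h : M * M) := sc_param c1 h.1 * sc_param c2 h.2 in
     smooth_on
       [set h | [/\ sc_cod c1 (j h.1), sc_cod c2 (j h.2) & sc_dom c3 (mul h)]]
       (fun h => sc_coord c3 (mul h))) /\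
  (forall c1 c2 : slice_chart j G,
     let inv (h : M) := opinv (sc_param c1 h) in
     smooth_on
       [set h | sc_cod c1 (j h) /\ sc_dom c2 (inv h)]
       (fun h => sc_coord c2 (inv h))).

(* The domains of the charts of G are traces of open sets of B(V), so the
   manifold topology of G is the one induced by the norm. *)
Definition embedded_lie_subgroup (G : set BV) : Prop :=
  [/\ GL_subgroup G,
      closure G `&` GL `<=` G &
      exists (M : completeNormedModType R) (j : bop M BV),
        [/\ forall h, `|j h| = `|h|,
            embedded_submanifold j G &
            smooth_group_law j G]].

Definition Lie (G : set BV) : set BV :=
  [set H | forall t : R, G (opexp (t *: H))].

End OperatorGroups.

Arguments GL {R} V.

HB.mixin Record CompleteNormedModule_isJBAlgebra (R : realType) V
    & CompleteNormedModule R V := {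
  jmul : V -> V -> V;
  jone : V;
  jmulC : commutative jmul;
  jmulDl : left_distributive jmul +%R;
  jmulZl : forall (a : R) (x y : V), jmul (a *: x) y = a *: jmul x y;
  jmul1l : left_id jone jmul;
  jordan_identity : forall x y : V,
    jmul (jmul x x) (jmul x y) = jmul x (jmul (jmul x x) y);
  jnormM : forall x y : V, `|jmul x y| <= `|x| * `|y|;
  jnorm_sqr : forall x : V, `|jmul x x| = `|x| ^+ 2;
  jnorm_sqrD : forall x y : V, `|jmul x x| <= `|jmul x x + jmul y y|
}.

#[short(type="jbAlgebraType")]
HB.structure Definition JBAlgebra (R : realType) :=
  { V of CompleteNormedModule_isJBAlgebra R V & CompleteNormedModule R V }.

Section JBAlgebras.
Context {R : realType} {V : jbAlgebraType R}.
Notation BV := (bop V V).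

Lemma jmul_bounded_operator (x : V) : bounded_operator (jmul x).
Proof.
split=> [a y z|]; last by exists `|x| => y; exact: jnormM.
by rewrite ![jmul x _]jmulC jmulDl jmulZl.
Qed.

Definition Lop (x : V) : BV := mkbop (jmul_bounded_operator x).

Definition Uop (x : V) : BV := (Lop x ^+ 2) *+ 2 - Lop (jmul x x).

Definition Str : set BV :=
  [set g | GL V g /\
     exists gs : BV, GL V gs /\ forall x : V, Uop (g x) = g * Uop x * gs].

Definition Aut : set BV :=
  [set k | GL V k /\ forall a b : V, k (jmul a b) = jmul (k a) (k b)].

Definition Der : set BV :=
  [set D | forall x y : V, D (jmul x y) = jmul (D x) y + jmul x (D y)].

End JBAlgebras.

Arguments Str {R} V.
Arguments Aut {R} V.
Arguments Der {R} V.

(* Main.v *)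
(* Letting g act on bilinear products m : V x V -> V by
   g.m = g m(g^-1 ., g^-1 .), Aut(V) is the stabilizer of the Jordan product m0,
   and Der(V) is the kernel of X |-> d_X m0, where
   d_X m = X m(., .) - m(X ., .) - m(., X .). Since exp(X).m = exp(d_X) m and
   |d_X| <= 3 |X|, the identity exp(B /\ Lie Aut) = exp(B) /\ Aut reduces to: if
   |d| <= 24/5 and exp(d) m = m, then d m = 0; this applies because
   3 pi / 2 < 24/5. Hence x |-> log(g^-1 x) is, near g in Aut(V), a slice chart
   taking Aut(V) to the closed subspace Der(V). The exponential and the logarithm
   are smooth as sums of power series whose derivatives are dominated termwise,
   and the group operations are smooth in all slice charts because they are so in
   B(V) and an isometry onto a closed subspace reflects smoothness. *)
From HB Require Import structures.
Require Import Defs.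
From mathcomp Require Import all_boot all_order all_algebra.
From mathcomp Require Import all_classical all_reals all_analysis.
From mathcomp Require Import ring lra.
Set Implicit Arguments.
Unset Strict Implicit.
Unset Printing Implicit Defensive.
Import Order.TTheory GRing.Theory Num.Theory.
Import numFieldNormedType.Exports.
Local Open Scope classical_set_scope.
Local Open Scope ring_scope.

(** * Bounded operators *)

(** The radius pi/2 forces exponentials of operators of norm up to 3 pi/2, about 4.71, to be
    controlled on a real Banach space, where the usual spectral argument would require a
    complexification. Cruder series estimates stop too early: comparing exp(T) - 1 - T with T works
    only for |T| below about 1.26, and comparing sinh(T/2) - T/2 with T/2 only below about 4.35.
    Removing the cubic term as well carries the range past 3 pi/2. The number 24/5 is three times
    8/5, a rational upper bound for pi/2 that a short partial sum of the cosine series certifies.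
    The same injectivity result serves a second time: it yields log(exp Y) = Y from exp(log(1 + z))
    = 1 + z, so that the two power series are never composed formally. Since Der(V) may have no
    closed complement in B(V), charts cannot come from a splitting of B(V), and smoothness in Der(V)
    cannot be read off through a projection. Difference quotients take over: they stay in the closed
    subspace, and so do their limits. *)

Section BopComplete.
Context {R : realType} {E : normedModType R} {F : completeNormedModType R}.
Notation BEF := (bop E F).

Lemma bop_cauchy_pointwise (G : set_system BEF) : ProperFilter G -> cauchy G ->
  forall x, cvg ((T : BEF) x @[T --> G]).
Proof.
move=> GG /cauchyP Gc x; apply/cauchy_cvgP/cauchy_exP => e e0.
have x0 : 0 < `|x| + 1 by rewrite ltr_wpDl.
have [T GT] := Gc (e / (`|x| + 1)) (divr_gt0 e0 x0).
exists (T x); suff : G [set S : BEF | ball (T x) e (S x)] by [].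
apply: filterS GT => S; rewrite -!ball_normE /= => TS.
rewrite (_ : T x - S x = (T - S) x)//; apply: le_lt_trans (le_opnorm _ _) _.
move: TS; rewrite ltr_pdivlMr//; apply: le_lt_trans.
by apply: ler_wpM2l; [exact: opnorm_ge0|rewrite lerDl].
Qed.

Lemma bop_complete (G : set_system BEF) : ProperFilter G -> cauchy G -> cvg G.
Proof.
move=> GG Gc; have Gcv := bop_cauchy_pointwise GG Gc.
pose l x : F := lim ((T : BEF) x @[T --> G]).
(* A norm bound passes to the pointwise limit. This single estimate gives both the boundedness of
   [l] and the convergence in norm. *)
have lE (T0 : BEF) e x : G (ball T0 e) -> `|T0 x - l x| <= e * `|x|.
  move=> GT; have : (T0 x - (T : BEF) x) @[T --> G] --> T0 x - l x.
    by apply: (@cvgB _ _ _ G _ (fun=> T0 x)); [exact: cvg_cst|exact: Gcv].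
  move=> /cvg_norm /cvgr_to_le; apply.
  suff : G [set S : BEF | `|T0 x - S x| <= e * `|x|] by [].
  apply: filterS GT => S.
  rewrite -ball_normE /= => TS; rewrite (_ : T0 x - S x = (T0 - S) x)//.
  by apply: le_trans (le_opnorm _ _) _; rewrite ler_wpM2r// ltW.
have llin : linear l.
  move=> a x y; apply: cvg_lim => //.
  under eq_cvg => T do rewrite linearP.
  apply: (@cvgD _ _ _ G _ (fun T : BEF => a *: T x)); last exact: Gcv.
  by apply: (@cvgZ _ _ _ G _ (fun=> a)); [exact: cvg_cst|exact: Gcv].
have [T0 GT0] := (cauchyP G).1 Gc 1 ltr01.
have lb : bounded_operator l.
  split=> //; exists (opnorm T0 + 1) => x.
  rewrite -[l x](subrK (T0 x)) (le_trans (ler_normD _ _))// addrC mulrDl lerD//.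
    exact: le_opnorm.
  by rewrite distrC lE.
apply/cvg_ex; exists (mkbop lb); apply/cvgrPdist_le => /= e e0.
have [T GT] := (cauchyP G).1 Gc (e / 2) (divr_gt0 e0 (ltr0n _ 2)).
near=> S.
apply: opnorm_le => x x1; rewrite [X in `|X|](_ : _ = l x - S x)//.
rewrite -(subrK (T x) (l x)) -addrA (le_trans (ler_normD _ _))//.
rewrite (splitr e) lerD//.
  rewrite distrC (le_trans (lE _ _ _ GT))// ler_piMr//.
  by rewrite divr_ge0// ltW.
rewrite (_ : T x - S x = (T - S) x)// (le_trans (le_opnorm _ _))//.
rewrite (le_trans (_ : _ <= opnorm (T - S)))//.
  by rewrite ler_piMr// opnorm_ge0.
have : ball T (e / 2) S by near: S.
by rewrite -ball_normE => /ltW.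
Unshelve. all: by end_near. Qed.

HB.instance Definition _ := Uniform_isComplete.Build (bop E F) bop_complete.
End BopComplete.

Section BopBasics.
Context {R : realType}.
Implicit Types E F : normedModType R.

Lemma bop_continuous E F (T : bop E F) : continuous T.
Proof.
move=> x; apply/cvgrPdist_le => /= e e0.
have T1 : 0 < opnorm T + 1 by rewrite ltr_wpDl ?opnorm_ge0.
near=> y; rewrite -linearB (le_trans (le_opnorm _ _))//.
have : `|x - y| < e / (opnorm T + 1).
  by near: y; apply: cvgr_dist_lt; [exact: cvg_id|exact: divr_gt0].
rewrite ltr_pdivlMr// => /ltW; apply: le_trans.
by rewrite mulrC ler_wpM2l// lerDl.
Unshelve. all: by end_near. Qed.

Lemma bop_cvg E F (T : bop E F) (u : nat -> E) l :
  u @ \oo --> l -> (fun n => T (u n)) @ \oo --> T l.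
Proof. by move=> ul; apply: cvg_comp ul _; exact: bop_continuous. Qed.

Lemma norm_bop_apply E F (T : bop E F) x : `|T x| <= `|T| * `|x|.
Proof. exact: le_opnorm. Qed.

Lemma norm_bop_le E F (T : bop E F) (M : R) : 0 <= M ->
  (forall x, `|T x| <= M * `|x|) -> `|T| <= M.
Proof.
move=> M0 hM; apply: opnorm_le => x x1; apply: le_trans (hM x) _.
by rewrite ler_piMr.
Qed.

Lemma bop_addE E F (S T : bop E F) x : (S + T) x = S x + T x.
Proof. by []. Qed.

Lemma bop_oppE E F (T : bop E F) x : (- T) x = - T x.
Proof. by []. Qed.

Lemma bop_subE E F (S T : bop E F) x : (S - T) x = S x - T x.
Proof. by []. Qed.

Lemma bop_scaleE E F a (T : bop E F) x : (a *: T) x = a *: T x.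
Proof. by []. Qed.

Lemma bop_zeroE E F x : (0 : bop E F) x = 0.
Proof. by []. Qed.

Lemma bop_mulE E (S T : bop E E) x : (S * T) x = S (T x).
Proof. by []. Qed.

Lemma bop_oneE E x : (1 : bop E E) x = x.
Proof. by []. Qed.

Lemma bop_scalerAl E a (S T : bop E E) : (a *: S) * T = a *: (S * T).
Proof. exact: bop_eq. Qed.

Lemma bop_scalerAr E a (S T : bop E E) : S * (a *: T) = a *: (S * T).
Proof. by apply: bop_eq => x; rewrite /= linearZ. Qed.

Lemma norm_bop_mul E (S T : bop E E) : `|S * T| <= `|S| * `|T|.
Proof.
apply: norm_bop_le => [|x]; first by rewrite mulr_ge0.
apply: le_trans (norm_bop_apply S _) _.
by rewrite -mulrA ler_wpM2l// norm_bop_apply.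
Qed.

Lemma norm_bop_one E : `|1 : bop E E| <= 1.
Proof. by apply: norm_bop_le => // x; rewrite mul1r. Qed.

Lemma norm_bop_exp E (T : bop E E) n : `|T ^+ n| <= `|T| ^+ n.
Proof.
elim: n => [|n IHn]; first by rewrite !expr0 norm_bop_one.
rewrite !exprS; apply: le_trans (norm_bop_mul _ _) _.
by rewrite ler_wpM2l.
Qed.

Lemma bop_expS E (T : bop E E) n x : (T ^+ n.+1) x = T ((T ^+ n) x).
Proof. by rewrite exprS. Qed.

Lemma bop_expZ E (T : bop E E) a n : (a *: T) ^+ n = a ^+ n *: T ^+ n.
Proof.
elim: n => [|n IHn]; first by rewrite !expr0 scale1r.
by rewrite !exprS IHn bop_scalerAl bop_scalerAr scalerA.
Qed.

Lemma bopB (E F : normedModType R) (T : bop E F) x y : T (x - y) = T x - T y.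
Proof. exact: linearB. Qed.

Lemma bopD (E F : normedModType R) (T : bop E F) x y : T (x + y) = T x + T y.
Proof. exact: linearD. Qed.

Lemma bopZ (E F : normedModType R) (T : bop E F) a x : T (a *: x) = a *: T x.
Proof. exact: linearZ_LR. Qed.

Section Bilinear.
Context {E1 E2 F : normedModType R} (f : E1 -> E2 -> F) (M : R).
Context (f_linl : forall y, linear (f^~ y)) (f_linr : forall x, linear (f x)).
Context (f_bnd : forall x y, `|f x y| <= M * `|x| * `|y|).

Lemma bilinear_bounded_inner x : bounded_operator (f x).
Proof. by split=> //; exists (M * `|x|). Qed.

Lemma bilinear_bounded_outer :
  bounded_operator (fun x => mkbop (bilinear_bounded_inner x)).
Proof.
split=> [a x y|]; first by apply: bop_eq => z /=; rewrite f_linl.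
exists `|M| => x; apply: norm_bop_le => [|y]; first by rewrite mulr_ge0.
apply: le_trans (f_bnd x y) _.
by rewrite !ler_wpM2r// ler_norm.
Qed.

(** Bounded bilinear maps are kept curried, so that composition, evaluation of products, the Leibniz
    rule and the chain rule are all instances of one pattern [B x y]. *)
Definition bilin_bop : bop E1 (bop E2 F) := mkbop bilinear_bounded_outer.

Lemma norm_bilin_bop : 0 <= M -> `|bilin_bop| <= M.
Proof.
move=> M0; apply: norm_bop_le => // x.
by apply: norm_bop_le => [|y]; [exact: mulr_ge0|exact: f_bnd].
Qed.

End Bilinear.

Lemma norm_bop_apply2 E1 E2 F (B : bop E1 (bop E2 F)) x y :
  `|B x y| <= `|B| * `|x| * `|y|.
Proof.
apply: le_trans (norm_bop_apply _ _) _.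
by rewrite ler_wpM2r// norm_bop_apply.
Qed.

Lemma norm_bcomp_apply (E1 E2 E3 : normedModType R) (S : bop E2 E3)
  (T : bop E1 E2) x : `|S (T x)| <= `|S| * `|T| * `|x|.
Proof.
apply: le_trans (norm_bop_apply _ _) _.
by rewrite -mulrA ler_wpM2l// norm_bop_apply.
Qed.

Lemma bcomp_bounded (E1 E2 E3 : normedModType R) (S : bop E2 E3)
  (T : bop E1 E2) : bounded_operator (S \o T).
Proof.
split=> [a x y /=|]; first by rewrite !linearP.
by exists (`|S| * `|T|) => x; exact: norm_bcomp_apply.
Qed.

Definition bcomp (E1 E2 E3 : normedModType R) (S : bop E2 E3)
  (T : bop E1 E2) : bop E1 E3 := mkbop (bcomp_bounded S T).

Lemma norm_bcomp (E1 E2 E3 : normedModType R) (S : bop E2 E3)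
  (T : bop E1 E2) : `|bcomp S T| <= `|S| * `|T|.
Proof.
apply: norm_bop_le => [|x]; first by rewrite mulr_ge0.
exact: norm_bcomp_apply.
Qed.

(** Kept transparent, so that [comp_bop E1 E2 E3 S T x] is convertible to [S (T x)]; many identities
    between composed operators below then hold by conversion. *)
Definition comp_bop (E1 E2 E3 : normedModType R) :
    bop (bop E2 E3) (bop (bop E1 E2) (bop E1 E3)).
Proof.
apply: (@bilin_bop _ _ _ (@bcomp E1 E2 E3) 1).
- by move=> T a S S'; apply: bop_eq.
- by move=> S a T T'; apply: bop_eq => x; rewrite /= linearP.
- by move=> S T; rewrite mul1r norm_bcomp.
Defined.

Definition eval_bop E F (x : E) : bop (bop E F) F.
Proof.
apply: (@mkbop _ _ _ (fun T : bop E F => T x)); split=> //.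
by exists `|x| => T; rewrite mulrC norm_bop_apply.
Defined.

Definition lmul_bop E (S : bop E E) : bop (bop E E) (bop E E) :=
  comp_bop E E E S.

Definition rmul_bop E (S : bop E E) : bop (bop E E) (bop E E).
Proof.
apply: (@mkbop _ _ _ (fun T : bop E E => T * S)); split=> [a T T'|].
  by rewrite mulrDl bop_scalerAl.
by exists `|S| => T; rewrite mulrC norm_bop_mul.
Defined.

Lemma lmul_bopE E (S T : bop E E) : lmul_bop S T = S * T.
Proof. exact: bop_eq. Qed.

Lemma rmul_bopE E (S T : bop E E) : rmul_bop S T = T * S.
Proof. exact: bop_eq. Qed.

End BopBasics.

(** * Dominated series and the Cauchy product *)

Section Series.
Context {R : realType}.

Lemma series_dom_cvg (F : completeNormedModType R) (u : nat -> F)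
  (v : nat -> R) : (forall n, `|u n| <= v n) -> cvgn (series v) ->
  cvgn (series u).
Proof.
move=> uv cv; apply: normed_cvg; apply: (series_le_cvg _ _ uv cv) => // n.
exact: le_trans (uv n).
Qed.

Lemma series_dom_lim (F : completeNormedModType R) (u : nat -> F)
  (v : nat -> R) : (forall n, `|u n| <= v n) -> cvgn (series v) ->
  `|limn (series u)| <= limn (series v).
Proof.
move=> uv cv; have cnu : cvgn [normed series u].
  by apply: (series_le_cvg _ _ uv cv) => // n; exact: le_trans (uv n).
by apply: le_trans (lim_series_norm cnu) _; apply: lim_series_le.
Qed.

Lemma bop_series (E F : normedModType R) (T : bop E F) (u : nat -> E) l :
  series u @ \oo --> l -> series (fun n => T (u n)) @ \oo --> T l.
Proof.
move=> /(@bop_cvg _ _ _ T); suff -> : (fun n => T (series u n)) = series (T \o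
  u) by [].
by apply/funext => n; rewrite !seriesEord/= linear_sum.
Qed.

Lemma bop_series_lim (E F : normedModType R) (T : bop E F) (u : nat -> E) :
  cvgn (series u) -> T (limn (series u)) = limn (series (fun n => T (u n))).
Proof. by move=> cu; apply/esym/cvg_lim => //; exact: bop_series. Qed.

Lemma norm_cvg_le (F : normedModType R) (u : nat -> F) l (M : R) :
  u @ \oo --> l -> (forall n, `|u n| <= M) -> `|l| <= M.
Proof.
by move=> /cvg_norm /cvgr_to_le ul uM; apply: ul; near=> n; exact: uM.
Unshelve. all: by end_near. Qed.

Lemma cvg0_of_norm_le (F : normedModType R) (u : nat -> F) (v : nat -> R) :
  (forall n, `|u n| <= v n) -> v @ \oo --> 0 -> u @ \oo --> 0.
Proof.
move=> uv /cvgr0Pnorm_le v0; apply/cvgr0Pnorm_le => e e0.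
near=> n; apply: le_trans (uv n) _.
apply: le_trans (ler_norm _) _; near: n; exact: v0.
Unshelve. all: by end_near. Qed.

Lemma triangular_sum (A : zmodType) (G : nat -> nat -> A) N :
  \sum_(n < N) \sum_(i < n.+1) G i (n - i)%N =
  \sum_(i < N) \sum_(j < N - i) G i j.
Proof.
elim: N => [|N IHN]; first by rewrite !big_ord0.
rewrite big_ord_recr/= IHN [RHS]big_ord_recr/= subSnn big_ord1.
rewrite [in LHS](big_ord_recr N)/= addrA subnn; congr (_ + _).
rewrite -big_split/=; apply: eq_bigr => i _.
by rewrite subSn ?big_ord_recr// ltnW.
Qed.

(* The remainder has the same expression for operators and for the real series
   of their norms, where it tends to 0. *)
Lemma cauchy_product_rest (A : pzRingType) (f g h : nat -> A) N :
  (forall n, h n = \sum_(i < n.+1) f i * g (n - i)%N) ->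
  (\sum_(i < N) f i) * (\sum_(i < N) g i) - \sum_(i < N) h i =
  \sum_(i < N) \sum_(N - i <= j < N) f i * g j.
Proof.
move=> hE; under [X in _ - X]eq_bigr do rewrite hE.
rewrite (triangular_sum (fun i j => f i * g j)) mulr_suml -sumrB.
apply: eq_bigr => i _; rewrite mulr_sumr.
rewrite -(big_mkord predT (fun j => f i * g j)).
rewrite -(big_mkord predT (fun j => f i * g j)).
by rewrite (@big_cat_nat _ _ _ (N - i))//= ?leq_subr// addrAC subrr add0r.
Qed.

End Series.

Arguments bop_cvg {R E F} T {u l}.
Arguments bop_series {R E F} T {u l}.
Arguments bop_series_lim {R E F} T {u}.

(** * The exponential *)

Section Exponential.
Context {R : realType} {V : completeNormedModType R}.
Implicit Types X Y : bop V V.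

Definition expt X (n : nat) : bop V V := (n`!%:R : R)^-1 *: X ^+ n.

Lemma norm_expt X n : `|expt X n| <= exp_coeff `|X| n.
Proof.
rewrite normrZ /exp_coeff/= mulrC ger0_norm ?invr_ge0//.
by rewrite ler_wpM2r ?invr_ge0// norm_bop_exp.
Qed.

Lemma opexp_cvg X : series (expt X) @ \oo --> opexp X.
Proof.
apply: series_dom_cvg (norm_expt X) _; exact: is_cvg_series_exp_coeff.
Qed.

Lemma opexp_cvg_apply X v : series (fun n => expt X n v) @ \oo --> opexp X v.
Proof. exact: (bop_series (eval_bop V v) (opexp_cvg (X := X))). Qed.

Lemma opexp_fix X v : X v = 0 -> opexp X v = v.
Proof.
move=> Xv; have /cvg_lim <- := @opexp_cvg_apply X v => //; apply: cvg_lim => //.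
(* Every partial sum except the empty one equals [v], hence the shift by one. *)
rewrite -cvg_shiftS; apply: cvg_near_cst; near=> n.
rewrite [LHS](_ : _ = \sum_(0 <= i < n.+1) expt X i v)//.
rewrite big_nat_recl// big1 ?addr0 => [|i _].
  by rewrite /expt fact0 invr1 scale1r expr0.
by rewrite /expt exprSr bop_scaleE bop_mulE Xv linear0 scaler0.
Unshelve. all: by end_near. Qed.

Lemma opexp0 : opexp (0 : bop V V) = 1.
Proof. by apply: bop_eq => v; rewrite opexp_fix. Qed.

(** Only powers of a single operator enter, so antimorphisms qualify as well as morphisms;
    precomposition, which reverses products, relies on this. *)
Lemma opexp_morph (W : completeNormedModType R)
    (phi : bop (bop V V) (bop W W)) X :
  (forall n, phi (X ^+ n) = phi X ^+ n) -> phi (opexp X) = opexp (phi X).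
Proof.
move=> phiX; rewrite bop_series_lim; last exact/cvgP/opexp_cvg.
congr (limn (series _)); apply/funext => n.
by rewrite /expt linearZ/= phiX.
Qed.

End Exponential.

Section ExponentialAdd.
Context {R : realType}.

Lemma mul_bop_cvg (V : normedModType R) (u v : nat -> bop V V) (a b : bop V V) :
  u @ \oo --> a -> v @ \oo --> b -> (fun n => u n * v n) @ \oo --> a * b.
Proof.
move=> ua vb; apply/subr_cvg0.
apply: (@cvg0_of_norm_le _ _ _
  (fun n => `|u n - a| * `|v n| + `|a| * `|v n - b|)) => [n|].
  rewrite -[_ - _](_ : (u n - a) * v n + a * (v n - b) = _); last first.
    by rewrite mulrBl mulrBr addrA subrK.
  by apply: le_trans (ler_normD _ _) _; rewrite lerD// norm_bop_mul.
rewrite -[X in _ --> X](addr0 0) -[X in _ --> X + _](mul0r `|b|).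
rewrite -[X in _ --> _ + X](mulr0 `|a|).
apply: cvgD; apply: cvgM; [|exact: cvg_norm|exact: cvg_cst|].
  by apply/norm_cvg0P; apply/subr_cvg0.
by apply/norm_cvg0P; apply/subr_cvg0.
Qed.

Lemma series_exp_coeff_le (x : R) n : 0 <= x -> series (exp_coeff x) n <= expR
  x.
Proof.
move=> x0; apply: nondecreasing_cvgn_le; last exact: is_cvg_series_exp_coeff.
by apply: nondecreasing_series => k _ _; exact: exp_coeff_ge0.
Qed.

Lemma bin_inv_fact n i : (i <= n)%N ->
  (n`!%:R)^-1 * 'C(n, i)%:R = (i`!%:R)^-1 * ((n - i)`!%:R)^-1 :> R.
Proof.
move=> ni; rewrite -(bin_fact ni) !natrM; field.
by rewrite !pnatr_eq0 -!lt0n !fact_gt0 bin_gt0 ni.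
Qed.

Lemma exp_coeffD (x y : R) n :
  exp_coeff (x + y) n = \sum_(i < n.+1) exp_coeff x i * exp_coeff y (n - i)%N.
Proof.
rewrite /exp_coeff/= addrC exprDn mulr_suml; apply: eq_bigr => i _.
have := bin_inv_fact (n := n) (i := i); rewrite -ltnS => /(_ (ltn_ord i)) nE.
transitivity (y ^+ (n - i)%N * x ^+ i * ((n`!%:R)^-1 * 'C(n, i)%:R)).
  by rewrite -mulr_natr; ring.
by rewrite nE; ring.
Qed.

Lemma exptD (V : completeNormedModType R) (X Y : bop V V) n : X * Y = Y * X ->
  expt (X + Y) n = \sum_(i < n.+1) expt X i * expt Y (n - i)%N.
Proof.
move=> XY; rewrite /expt addrC exprDn_comm; last exact/esym.
rewrite scaler_sumr; apply: eq_bigr => i _.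
rewrite -[_ *+ 'C(n, i)]scaler_nat scalerA bin_inv_fact; last by rewrite -ltnS.
rewrite bop_scalerAl bop_scalerAr scalerA; congr (_ *: _).
by apply/commrX/commr_sym/commrX.
Qed.

Lemma opexpD (V : completeNormedModType R) (X Y : bop V V) : X * Y = Y * X ->
  opexp (X + Y) = opexp X * opexp Y.
Proof.
move=> XY; apply/esym/subr0_eq.
pose D n := series (expt X) n * series (expt Y) n - series (expt (X + Y)) n.
have Dcvg : D @ \oo --> opexp X * opexp Y - opexp (X + Y).
  by apply: cvgB; [apply: mul_bop_cvg; exact: opexp_cvg|exact: opexp_cvg].
have /cvg_lim <- := Dcvg => //; apply: cvg_lim => //.
pose e := @exp_coeff R; pose a := `|X|; pose b := `|Y|.
(* The remainder of the Cauchy product is dominated term by term by the one for the real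
   exponentials at [a] and [b], which tends to 0 by [expRD]. *)
apply: (@cvg0_of_norm_le _ _ _
    (fun n => series (e a) n * series (e b) n - series (e (a + b)) n)) => [n|].
  rewrite /D !seriesEord/= (cauchy_product_rest _ (fun n => exptD n XY)).
  rewrite (cauchy_product_rest _ (exp_coeffD a b)).
  apply: le_trans (ler_norm_sum _ _ _) _; apply: ler_sum => i _.
  apply: le_trans (ler_norm_sum _ _ _) _; apply: ler_sum => j _.
  apply: le_trans (norm_bop_mul _ _) _.
  by rewrite ler_pM// norm_expt.
rewrite -[X in _ --> X](subrr (expR (a + b))) [X in _ --> X - _]expRD.
by apply: cvgB; [apply: cvgM|]; exact: is_cvg_series_exp_coeff.
Qed.
Lemma opexpN (V : completeNormedModType R) (X : bop V V) :
  opexp X * opexp (- X) = 1.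
Proof. by rewrite -opexpD ?subrr ?opexp0// mulrN mulNr. Qed.

Lemma opexpNl (V : completeNormedModType R) (X : bop V V) :
  opexp (- X) * opexp X = 1.
Proof. by rewrite -{2}[X]opprK opexpN. Qed.

Lemma opexp_comm (V : completeNormedModType R) (X Y : bop V V) :
  X * Y = Y * X -> X * opexp Y = opexp Y * X.
Proof.
move=> XY; rewrite -lmul_bopE -rmul_bopE.
rewrite !bop_series_lim; try exact/cvgP/opexp_cvg.
congr (limn (series _)); apply/funext => n.
rewrite lmul_bopE rmul_bopE bop_scalerAl bop_scalerAr; congr (_ *: _).
exact/commrX.
Qed.

(** The quadratic remainder is what makes the increments of [U] quadratic in the proof of exp(log(1
    + z)) = 1 + z, and what differentiates one-parameter groups at 0. *)
Lemma opexp_taylor1 (V : completeNormedModType R) (X : bop V V) :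
  `|opexp X - 1 - X| <= `|X| ^+ 2 * expR `|X|.
Proof.
have : (fun n => series (expt X) (n + 2)%N - 1 - X) @ \oo --> opexp X - 1 - X.
  apply: cvgB; [apply: cvgB|]; [|exact: cvg_cst|exact: cvg_cst].
  by rewrite (cvg_shiftn 2 (series (expt X))); exact: opexp_cvg.
move=> /norm_cvg_le; apply => n.
have -> : series (expt X) (n + 2)%N - 1 - X = \sum_(i < n) expt X i.+2.
  rewrite addn2 seriesEord [X in X - _ - _](_ : _ = \sum_(i < n.+2) expt X i)//.
  rewrite 2!big_ord_recl addrA [expt X ord0 + _](_ : _ = 1 + X).
    by rewrite -addrA -opprD addrAC subrr add0r.
  by rewrite /expt fact0 invr1 !scale1r.
apply: le_trans (ler_norm_sum _ _ _) _.
apply: (@le_trans _ _ (`|X| ^+ 2 * series (exp_coeff `|X|) n)).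
  rewrite seriesEord/= mulr_sumr; apply: ler_sum => i _.
  apply: le_trans (norm_expt _ _) _.
  rewrite /exp_coeff/= mulrA -exprD add2n ler_wpM2l ?exprn_ge0//.
  rewrite lef_pV2 ?posrE ?ltr0n ?fact_gt0// ler_nat.
  by rewrite !factS mulnA leq_pmull.
by rewrite ler_wpM2l ?exprn_ge0// series_exp_coeff_le.
Qed.
End ExponentialAdd.

(** * Fixed vectors of the exponential of a small operator *)

Section PiBound.
Context {R : realType}.

(** The first three terms of [- cos] at 8/5 already sum to -1 + 32/25 - 512/1875 = 13/1875 > 0, and
    the later terms are grouped into positive pairs. *)
Lemma cos_8_5_lt0 : cos (8 / 5) < 0 :> R.
Proof.
rewrite -(opprK (cos _)) oppr_lt0.
have /cvgN h := @cvg_cos_coeff' R (8 / 5).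
rewrite -(cvg_lim (@Rhausdorff R) h).
apply: (@lt_trans _ _ (\sum_(0 <= i < 3) - cos_coeff' (8 / 5) i)).
  rewrite !big_nat_recl// big_nil /cos_coeff' !factS fact0 /=.
  rewrite -!exprnP; lra.
rewrite -seriesN lt_sum_lim_series//.
  by move/cvgP in h; rewrite seriesN.
move=> d; rewrite /cos_coeff' -!exprnP addnS.
(* The pairs start at the odd index [m], where the term of [- cos] is positive. The next term is
   smaller in absolute value by the factor (64/25) / (p q), which is below 1 because p q >= 4. *)
set m := (3 + d.*2)%N.
have mE : (-1) ^+ m = -1 :> R by rewrite -signr_odd /m oddD odd_double expr1.
have m0 : (0 < m)%N by [].
move: m mE m0 => m mE m0.
rewrite exprS mE. rewrite !mulN1r !mulNr !opprK !mul1r subr_gt0.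
rewrite doubleS 2!exprS 2!factS !natrM.
set y := (8 / 5) ^+ _; set f := (_`!)%:R.
set p := m.*2.+2%:R; set q := m.*2.+1%:R.
have y0 : 0 < y by rewrite exprn_gt0//; lra.
have f0 : 0 < f by rewrite ltr0n fact_gt0.
have p2 : 2 <= p by rewrite ler_nat.
have q2 : 2 <= q by rewrite ler_nat ltnS double_gt0.
have pq : 4 <= p * q by nra.
have -> : 8 / 5 * (8 / 5 * y) / (p * (q * f)) = y / f * (64 / 25 / (p * q)).
  by field; rewrite !gt_eqF//; lra.
rewrite gtr_pMr ?divr_gt0// ltr_pdivrMr; lra.
Qed.

Lemma pihalf_lt_8_5 : pi / 2 < 8 / 5 :> R.
Proof.
rewrite ltNge; apply/negP => le; have := cos_8_5_lt0.
by rewrite ltNge cos_ge0_pihalf// le andbT; have := @pi_gt0 R; lra.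
Qed.

End PiBound.

Section ExpInjective.
Context {R : realType}.

Definition sinh_coeff (k : nat) : R := ((k.*2.+1)`!%:R)^-1.

Lemma sinh_coeff_gt0 k : 0 < sinh_coeff k.
Proof. by rewrite invr_gt0 ltr0n fact_gt0. Qed.

Lemma sinh_coeffS k :
  sinh_coeff k = sinh_coeff k.+1 * (k.*2.+3%:R * k.*2.+2%:R).
Proof.
rewrite /sinh_coeff doubleS (factS k.*2.+2) (factS k.*2.+1).
rewrite (natrM _ k.*2.+3) (natrM _ k.*2.+2).
have a0 : (k.*2.+1)`!%:R != 0 :> R by rewrite pnatr_eq0 -lt0n fact_gt0.
have p0 : k.*2.+3%:R != 0 :> R by rewrite pnatr_eq0.
have q0 : k.*2.+2%:R != 0 :> R by rewrite pnatr_eq0.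
set a := (_ `!)%:R in a0 *; set p := _.+3%:R in p0 *; set q := _.+2%:R in q0 *.
by clearbody a p q; field; rewrite a0 p0 q0.
Qed.

(** Makes the coefficients that remain after multiplication by 1 - S^2/6 nonnegative. For [k = 0] it
    is an equality, which is the cancellation of the cubic term. *)
Lemma sinh_coeffS_le k : sinh_coeff k.+1 <= sinh_coeff k / 6.
Proof.
rewrite ler_pdivlMr// [leRHS]sinh_coeffS ler_wpM2l//;
  first exact/ltW/sinh_coeff_gt0.
by rewrite -natrM ler_nat (@leq_mul 3 2).
Qed.

Let u : R := (12 / 5) ^+ 2.

(** The extra term is a buffer that makes the bound inductive. Its factor 1/5 exceeds the 1/6 of the
    new summand, and the surplus is proportional to c/30 + 1 - u/5, which is positive since c =
    (2N+9)(2N+8) >= 72. The base case is numerical. Here [u] is the bound for |S|^2 when |S| <=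
    12/5. *)
Lemma sinh_tail N :
  \sum_(k < N.+3) (sinh_coeff k / 6 - sinh_coeff k.+1) * u ^+ k.+1 +
  sinh_coeff N.+3 * u ^+ N.+4 / 5 <= 19 / 20.
Proof.
elim: N => [|N IHN].
  have s0 : sinh_coeff 0 = 1 by rewrite /sinh_coeff -[_`!]/1%N invr1.
  have s1 : sinh_coeff 1 = 6^-1 by [].
  have s2 : sinh_coeff 2 = 120^-1 by [].
  have s3 : sinh_coeff 3 = 5040^-1 by [].
  rewrite !big_ord_recr big_ord0/= s0 s1 s2 s3 /u; lra.
apply: le_trans IHN; rewrite big_ord_recr/= -addrA lerD2l.
have f0 := sinh_coeff_gt0 N.+4; rewrite [sinh_coeff N.+3]sinh_coeffS.
rewrite (exprS _ N.+4); set c := _ * _%:R.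
have c72 : 72 <= c.
  by rewrite /c -natrM ler_nat (@leq_mul 9 8).
have u0 : 0 < u by rewrite /u; lra.
set w := u ^+ _; have w0 : 0 < w by rewrite exprn_gt0.
set f := sinh_coeff _ in f0 *.
rewrite -subr_ge0.
have -> : f * c * w / 5 - ((f * c / 6 - f) * w + f * (u * w) / 5) =
  f * w * (c / 30 + 1 - u / 5) by field.
apply: mulr_ge0; first by rewrite mulr_ge0 // ltW.
rewrite /u. clear -c72. lra.
Qed.

(* With S = T/2, exp(S) v = exp(-S) v says that sinh(S) v = 0. Applying
   1 - S^2/6 to this series cancels its S^3 term, so that S v is a series in
   S^5 v, S^7 v, ... of norm at most 19/20 `|S v|. The critical value 24/5 lies
   above 3 (pi / 2), which is the norm bound for [act_der X] below. *)
Lemma opexp_fix_inj (W : completeNormedModType R) (T : bop W W) v :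
  `|T| <= 24 / 5 -> opexp T v = v -> T v = 0.
Proof.
move=> T_le Tv; pose S := 2^-1 *: T.
have TS : T = S + S by rewrite /S -scalerDl (_ : _ + _ = 1) ?scale1r//; lra.
have S_le : `|S| <= 12 / 5.
  by rewrite normrZ ger0_norm ?invr_ge0//; lra.
have SN : opexp S v = opexp (- S) v.
  by rewrite -[in RHS]Tv TS opexpD// -bop_mulE mulrA opexpNl mul1r.
pose b k := (S ^+ k.*2.+1) v.
pose s N := \sum_(k < N) sinh_coeff k *: b k.
have s0 : s @ \oo --> 0.
  have oddE n : expt (- S) n v = (-1) ^+ n *: expt S n v.
    by rewrite /expt -scaleN1r bop_expZ !bop_scaleE !scalerA mulrC.
  (* Cutting both series at the even index 2N lets the terms be taken in pairs: the even powers
     cancel in the difference and the odd ones double. *)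
  have sE N : s N = 2^-1 *: (series (fun n => expt S n v) N.*2 -
                             series (fun n => expt (- S) n v) N.*2).
    rewrite /s !seriesEord -sumrB; elim: N => [|N IHN].
      by rewrite !big_ord0 scaler0.
    have rec2 (f : nat -> W) M :
      \sum_(i < M.+2) f i = \sum_(i < M) f i + (f M + f M.+1).
      by rewrite !big_ord_recr/= addrA.
    rewrite big_ord_recr IHN doubleS.
    rewrite (rec2 (fun n => expt S n v - expt (- S) n v)) [RHS]scalerDr.
    congr (_ + _); rewrite [X in X + _](_ : _ = 0); last first.
      by rewrite oddE -signr_odd odd_double scale1r subrr.
    rewrite add0r oddE -signr_odd oddS odd_double expr1 scaleN1r opprK.
    rewrite scalerDr -scalerDl (_ : 2^-1 + 2^-1 = 1) ?scale1r; last by lra.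
    by rewrite /expt bop_scaleE.
  rewrite (funext sE).
  rewrite -[X in _ --> X](scaler0 _ (2^-1 : R)) -[X in _ *: X](subrr (opexp S
    v)).
  rewrite [X in _ - X]SN; apply: cvgZl_tmp.
  have d2 : (fun N => N.*2) @ \oo --> \oo.
    apply/cvgnyPge => A; exists A => // n /= An; apply: leq_trans An _.
    by rewrite -addnn leq_addr.
  by apply: cvgB; apply: (cvg_comp _ _ d2); exact: opexp_cvg_apply.
have b_le k : `|b k| <= u ^+ k * `|b 0%N|.
  elim: k => [|k IHk]; first by rewrite expr0 mul1r.
  rewrite /b doubleS 2!bop_expS [u ^+ _]exprS -mulrA.
  apply: le_trans (norm_bop_apply _ _) _.
  rewrite (_ : u * _ = 12 / 5 * (12 / 5 * (u ^+ k * `|b 0%N|))); last first.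
    by rewrite /u; ring.
  apply: ler_pM => //; apply: le_trans (norm_bop_apply _ _) _.
  exact: ler_pM.
(* [s] is taken at [N.+1] in one place and at [N] in the other, so that both parts end with the same
   power S^(2N+1) and the difference is an exact finite sum. *)
pose w N := s N.+1 - 6^-1 *: (S ^+ 2) (s N).
have w0 : w @ \oo --> 0.
  rewrite -[X in _ --> X]subr0 -[X in _ --> _ - X](scaler0 _ (6^-1 : R)).
  rewrite -[X in _ --> _ - _ *: X](linear0 (S ^+ 2)).
  apply: cvgB; first by rewrite (cvg_shiftS s).
  by apply: cvgZl_tmp; exact: bop_cvg.
have bS k : (S ^+ 2) (b k) = b k.+1.
  by rewrite /b -bop_mulE -exprD add2n doubleS.
have b0E : b 0%N = S v by rewrite /b double0 expr1.
clearbody b.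
have wE N : w N = b 0%N -
  \sum_(k < N) (sinh_coeff k / 6 - sinh_coeff k.+1) *: b k.+1.
  have -> : w N = s N.+1 - 6^-1 *: \sum_(k < N) sinh_coeff k *: b k.+1.
    rewrite /w /s linear_sum; congr (_ - _ *: _); apply: eq_bigr => k _.
    by rewrite linearZ_LR; congr (_ *: _); exact: bS.
  rewrite /s big_ord_recl -addrA; congr (_ + _).
    by rewrite /sinh_coeff -[_`!]/1%N invr1 scale1r.
  rewrite scaler_sumr -sumrB -sumrN; apply: eq_bigr => k _.
  rewrite lift0 scalerA -scalerBl -[RHS]scaleNr.
  by congr (_ *: _); ring.
(* The index [N.+3] matches [sinh_tail], whose base case needs three terms; 1/20 is what the bound
   19/20 leaves. *)
have bw N : 1 / 20 * `|b 0%N| <= `|w N.+3|.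
  have -> : w N.+3 = b 0%N - (b 0%N - w N.+3) by rewrite subKr.
  apply: le_trans (lerB_dist _ _); rewrite wE subKr.
  suff : `|\sum_(k < N.+3) (sinh_coeff k / 6 - sinh_coeff k.+1) *: b k.+1| <=
         19 / 20 * `|b 0%N| by lra.
  apply: le_trans (ler_norm_sum _ _ _) _.
  apply: (@le_trans _ _ (\sum_(k < N.+3)
    (sinh_coeff k / 6 - sinh_coeff k.+1) * u ^+ k.+1 * `|b 0%N|)).
    apply: ler_sum => k _; rewrite normrZ ger0_norm ?subr_ge0 ?sinh_coeffS_le//.
    by rewrite -mulrA ler_wpM2l ?subr_ge0 ?sinh_coeffS_le.
  rewrite -mulr_suml ler_wpM2r//; apply: le_trans (sinh_tail N).
  have u0 : 0 <= u by exact: sqr_ge0.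
  rewrite lerDl divr_ge0// mulr_ge0 ?exprn_ge0//.
  exact/ltW/sinh_coeff_gt0.
have : 1 / 20 * `|b 0%N| <= `|(0 : W)|.
  have /cvg_norm /cvgr_to_ge : (fun N => w (N + 3)%N) @ \oo --> 0.
    by rewrite (cvg_shiftn 3 w).
  by apply; near=> N; rewrite addn3.
rewrite normr0 => b0; have {}b0 : `|b 0%N| <= 0 by lra.
move: b0.
rewrite normr_le0 b0E => /eqP Sv.
by rewrite TS bop_addE Sv addr0.
Unshelve. all: by end_near. Qed.

End ExpInjective.

(** * Derivations and automorphisms *)

Section PreComposition.
Context {R : realType}.

Definition precomp_bop (E1 E2 E3 : normedModType R) :
    bop (bop E1 E2) (bop (bop E2 E3) (bop E1 E3)).
Proof.
apply: (@bilin_bop _ _ _ _ (fun S T => @bcomp R E1 E2 E3 T S) 1).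
- by move=> T a S S'; apply: bop_eq => x; rewrite /= linearP.
- by move=> S a T T'; apply: bop_eq.
- by move=> S T; rewrite mul1r mulrC norm_bcomp.
Defined.

Lemma norm_comp_bop (E1 E2 E3 : normedModType R) (T : bop E2 E3) :
  `|comp_bop E1 E2 E3 T| <= `|T|.
Proof. by apply: norm_bop_le => // S; exact: norm_bcomp. Qed.

Lemma norm_precomp_bop (E1 E2 E3 : normedModType R) (T : bop E1 E2) :
  `|precomp_bop E1 E2 E3 T| <= `|T|.
Proof. by apply: norm_bop_le => // S; rewrite mulrC; exact: norm_bcomp. Qed.

Lemma morph_exp (V W : normedModType R) (phi : bop (bop V V) (bop W W)) X n :
  phi 1 = 1 -> {morph phi : S T / S * T} -> phi (X ^+ n) = phi X ^+ n.
Proof.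
move=> phi1 phiM; elim: n => [|n IHn]; first by rewrite !expr0.
by rewrite !exprS phiM IHn.
Qed.

Lemma antimorph_exp (V W : normedModType R) (phi : bop (bop V V) (bop W W))
    X n :
  phi 1 = 1 -> (forall S T, phi (S * T) = phi T * phi S) ->
  phi (X ^+ n) = phi X ^+ n.
Proof.
move=> phi1 phiM; elim: n => [|n IHn]; first by rewrite !expr0.
by rewrite exprS phiM IHn exprSr.
Qed.

Lemma bop_add3E (E1 E2 E3 F : normedModType R)
    (S T : bop E1 (bop E2 (bop E3 F))) m x y :
  (S + T) m x y = S m x y + T m x y.
Proof. by rewrite (bop_addE S T m) (bop_addE (S m) (T m) x) bop_addE. Qed.

End PreComposition.

Section ActionOnProducts.
Context {R : realType} {V : completeNormedModType R}.
Notation W := (bop V (bop V V)).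
Implicit Types X : bop V V.

Definition act_out : bop (bop V V) (bop W W) :=
  bcomp (comp_bop V (bop V V) (bop V V)) (comp_bop V V V).
Definition act_fst : bop (bop V V) (bop W W) := precomp_bop V V (bop V V).
Definition act_snd : bop (bop V V) (bop W W) :=
  bcomp (comp_bop V (bop V V) (bop V V)) (precomp_bop V V V).

Lemma act_outE X (m : W) x y : act_out X m x y = X (m x y).
Proof. by []. Qed.
Lemma act_fstE X (m : W) x y : act_fst X m x y = m (X x) y.
Proof. by []. Qed.
Lemma act_sndE X (m : W) x y : act_snd X m x y = m x (X y).
Proof. by []. Qed.

Lemma act_out_exp X : act_out (opexp X) = opexp (act_out X).
Proof.
apply: opexp_morph => n; apply: morph_exp => [|S T];
  by apply: bop_eq => m; apply: bop_eq => x; apply: bop_eq.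
Qed.

Lemma act_fst_exp X : act_fst (opexp X) = opexp (act_fst X).
Proof.
apply: opexp_morph => n; apply: antimorph_exp => [|S T];
  by apply: bop_eq => m; apply: bop_eq => x; apply: bop_eq.
Qed.

Lemma act_snd_exp X : act_snd (opexp X) = opexp (act_snd X).
Proof.
apply: opexp_morph => n; apply: antimorph_exp => [|S T];
  by apply: bop_eq => m; apply: bop_eq => x; apply: bop_eq.
Qed.

(** The signs are put on [X] instead of on the operators, so that the exponentials of the last two
    summands are directly the actions of [opexp (- X)]. *)
Definition act_der X : bop W W := act_out X + (act_fst (- X) + act_snd (- X)).

Lemma act_derE X (m : W) x y :
  act_der X m x y = X (m x y) - m (X x) y - m x (X y).
Proof.
rewrite /act_der bop_add3E bop_add3E act_outE act_fstE act_sndE addrA.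
by rewrite (bop_oppE X x) (bop_oppE X y) (linearN m) (linearN (m x)).
Qed.

Lemma norm_act_der X : `|act_der X| <= 3 * `|X|.
Proof.
have out_le : `|act_out X| <= `|X|.
  have -> : act_out X = comp_bop V (bop V V) (bop V V) (comp_bop V V V X) by [].
  exact: le_trans (norm_comp_bop _ _) (norm_comp_bop _ _).
have fst_le : `|act_fst (- X)| <= `|X|.
  by rewrite -(normrN X); exact: norm_precomp_bop.
have snd_le : `|act_snd (- X)| <= `|X|.
  have -> : act_snd (- X) =
    comp_bop V (bop V V) (bop V V) (precomp_bop V V V (- X)) by [].
  rewrite -(normrN X).
  exact: le_trans (norm_comp_bop _ _) (norm_precomp_bop _ _).
have := ler_normD (act_out X) (act_fst (- X) + act_snd (- X)).
have := ler_normD (act_fst (- X)) (act_snd (- X)).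
move=> fs os; rewrite /act_der; apply: le_trans os _; lra.
Qed.

(** Postcomposition and precomposition in either argument commute pairwise, so the exponential of
    their sum is the product of the three exponentials, each of which is the action of an
    exponential on V. *)
Lemma opexp_act_der X (m : W) x y :
  opexp (act_der X) m x y = opexp X (m (opexp (- X) x) (opexp (- X) y)).
Proof.
have out_fst Y : act_out X * act_fst Y = act_fst Y * act_out X.
  by apply: bop_eq => n; apply: bop_eq => a; apply: bop_eq.
have out_snd Y : act_out X * act_snd Y = act_snd Y * act_out X.
  by apply: bop_eq => n; apply: bop_eq => a; apply: bop_eq.
have fst_snd Y Z : act_fst Y * act_snd Z = act_snd Z * act_fst Y.
  by apply: bop_eq => n; apply: bop_eq => a; apply: bop_eq.
rewrite /act_der opexpD; last by rewrite mulrDr mulrDl out_fst out_snd.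
rewrite opexpD; last exact: fst_snd.
by rewrite -act_out_exp -act_fst_exp -act_snd_exp.
Qed.

End ActionOnProducts.

Section AutDer.
Context {R : realType} {V : jbAlgebraType R}.
Implicit Types X : bop V V.

Definition jmul_bop : bop V (bop V V).
Proof.
apply: (@bilin_bop _ _ _ _ (@jmul R V) 1) => [y a x z|x|x y].
- by rewrite jmulDl jmulZl.
- by have [] := jmul_bounded_operator x.
- by rewrite mul1r; exact: jnormM.
Defined.

Lemma jmul_bopE x y : jmul_bop x y = jmul x y.
Proof. by []. Qed.

Lemma opexp_GL X : GL V (opexp X).
Proof. by exists (opexp (- X)); rewrite opexpN opexpNl. Qed.

Lemma Der_act_der X : Der V X <-> act_der X jmul_bop = 0.
Proof.
split=> [DX|X0 x y].
  apply: bop_eq => x; apply: bop_eq => y; rewrite act_derE !jmul_bopE DX.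
  by rewrite -addrA -opprD subrr.
have : act_der X jmul_bop x y = 0 by rewrite X0.
rewrite act_derE !jmul_bopE => /eqP.
by rewrite -addrA -opprD subr_eq0 => /eqP.
Qed.

Lemma Aut_opexp X : Aut V (opexp X) <-> opexp (act_der X) jmul_bop = jmul_bop.
Proof.
have KX x : opexp X (opexp (- X) x) = x by rewrite -bop_mulE opexpN.
have XK x : opexp (- X) (opexp X x) = x by rewrite -bop_mulE opexpNl.
have actE x y : opexp (act_der X) jmul_bop x y =
    opexp X (jmul (opexp (- X) x) (opexp (- X) y)) := opexp_act_der _ _ _ _.
split=> [[_ AX]|Xfix].
  by apply: bop_eq => x; apply: bop_eq => y; rewrite actE AX !KX.
split=> [|a b]; first exact: opexp_GL.
by have := actE (opexp X a) (opexp X b); rewrite Xfix !XK => <-.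
Qed.

Lemma Der_Aut_opexp X : Der V X -> Aut V (opexp X).
Proof. by move/Der_act_der => X0; apply/Aut_opexp; exact: opexp_fix. Qed.

Lemma Aut_opexp_Der X : `|X| < pi / 2 -> Aut V (opexp X) -> Der V X.
Proof.
move=> Xlt /Aut_opexp AX; apply/Der_act_der.
apply: opexp_fix_inj AX; apply: le_trans (norm_act_der X) _.
(* 3 (pi / 2) < 3 (8 / 5) = 24 / 5. *)
by have := @pihalf_lt_8_5 R; lra.
Qed.

Lemma Der_scale a X : Der V X -> Der V (a *: X).
Proof.
move=> DX x y; rewrite !bop_scaleE DX scalerDr jmulZl [jmul x (_ *: _)]jmulC
  jmulZl.
by rewrite [jmul x _]jmulC.
Qed.

Lemma Lie_Aut : Lie (Aut V) = Der V.
Proof.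
apply/seteqP; split=> [X LX|X DX t]; last exact/Der_Aut_opexp/Der_scale.
have X1 : 0 < `|X| + 1 by rewrite ltr_wpDl.
have t0 : 0 < (`|X| + 1)^-1 by rewrite invr_gt0.
(* One small time is enough: rescaling brings [X] below norm 1 <= pi / 2, and derivations are stable
   under scaling back. *)
have : Der V ((`|X| + 1)^-1 *: X).
  apply: Aut_opexp_Der (LX _); rewrite normrZ gtr0_norm//.
  apply: (@lt_le_trans _ _ 1); last exact: pihalf_ge1.
  by rewrite mulrC ltr_pdivrMr// mul1r ltrDl.
move=> /(Der_scale (`|X| + 1)); rewrite scalerA divff ?scale1r//.
Qed.

Lemma Aut_opexp_ball :
  let B : set (bop V V) := [set X | `|X| < pi / 2%:R] in
  opexp @` (B `&` Lie (Aut V)) = (opexp @` B) `&` Aut V.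
Proof.
rewrite Lie_Aut; apply/seteqP; split=> [_ [X [BX DX] <-]|_ [[X BX <-] AX]].
  by split; [exists X|exact: Der_Aut_opexp].
by exists X => //; split=> //; exact: Aut_opexp_Der.
Qed.

End AutDer.

(** * Smooth maps *)

Section DiffEps.
Context {R : realType}.
Implicit Types E F G : normedModType R.

Lemma near0_eps E (P : E -> Prop) :
  (\forall h \near 0, P h) <->
  exists2 d : R, 0 < d & forall h, `|h| < d -> P h.
Proof.
split=> [/nbhs_ballP[d d0 dP]|[d d0 dP]].
  by exists d => // h hd; apply: dP; rewrite -ball_normE /= sub0r normrN.
apply/nbhs_ballP; exists d => // h; rewrite -ball_normE /= sub0r normrN.
exact: dP.
Qed.

(** The non-strict bound [e * |h|] admits [h = 0]. Boundedness of [L] supplies the continuity and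
    the uniqueness of the differential that [is_diff] involves. *)
Lemma is_diffP E F (x : E) (f : E -> F) (L : bop E F) :
  is_diff x f L <->
  forall e : R, 0 < e -> exists2 d : R, 0 < d &
    forall h, `|h| < d -> `|f (x + h) - f x - L h| <= e * `|h|.
Proof.
have eqE : (f \o shift x = cst (f x) + L +o_ 0 id) <->
    forall e : R, 0 < e -> exists2 d : R, 0 < d &
      forall h, `|h| < d -> `|f (x + h) - f x - L h| <= e * `|h|.
  split=> [/eqaddoP h e e0|h]; last (apply/eqaddoP => e e0).
    have /near0_eps[d d0 dP] := h e e0; exists d => // k kd.
    have := dP k kd; rewrite [X in `|X| <= _](_ : _ = f (x + k) - f x - L k)//.
    by rewrite [LHS](_ : _ = f (k + x) - (f x + L k))// opprD addrA [k +
      x]addrC.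
  apply/near0_eps; have [d d0 dP] := h e e0; exists d => // k kd.
  have := dP k kd; rewrite [X in _ -> `|X| <= _](_ : _ = f (x + k) - f x - L
    k)//.
  by rewrite [LHS](_ : _ = f (k + x) - (f x + L k))// opprD addrA [k + x]addrC.
split=> [fL|/eqE fL].
  apply/eqE; have /diff_locally := ex_diff (is_diff_def := fL).
  by rewrite (diff_val (is_diff_def := fL)).
have dE := diff_unique (@bop_continuous _ _ _ L) fL.
apply: DiffDef => //; apply/diff_locallyP; rewrite dE; split=> //.
exact: bop_continuous.
Qed.

Lemma continuousP_eps E F (f : E -> F) x :
  {for x, continuous f} <->
  forall e : R, 0 < e -> exists2 d : R, 0 < d &
    forall h, `|h| < d -> `|f (x + h) - f x| <= e.
Proof.
split=> [fx e e0|fx].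
  have /cvgrPdist_le /(_ e e0) /nbhs_ballP[d d0 dP] := fx.
  exists d => // h hd; rewrite distrC; apply: dP.
  by rewrite -ball_normE /= opprD addNKr normrN.
apply/cvgrPdist_le => e e0; have [d d0 dP] := fx e e0.
apply/nbhs_ballP; exists d => // y; rewrite -ball_normE /= => yd.
have := dP (y - x); rewrite (addrC x) subrK distrC => /(_ yd).
by rewrite distrC.
Qed.

Lemma is_diff_continuous E F (f : E -> F) x (L : bop E F) :
  is_diff x f L -> {for x, continuous f}.
Proof. by move=> fL; exact: differentiable_continuous (ex_diff (is_diff_def :=
  fL)). Qed.

Lemma is_diff_ext E F (U : set E) (f g : E -> F) x (L : bop E F) :
  open U -> U x -> (forall y, U y -> f y = g y) ->
  is_diff x f L -> is_diff x g L.
Proof.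
move=> Uo Ux fg /is_diffP fL; apply/is_diffP => e e0.
have [d d0 dP] := fL e e0.
have /nbhs_ballP[r r0 rU] : nbhs x U by exact: open_nbhs_nbhs.
exists (Num.min d r) => [|h]; first by rewrite lt_min d0.
rewrite lt_min => /andP[hd hr]; rewrite -!fg//; first exact: dP.
by apply: rU; rewrite -ball_normE /= opprD addNKr normrN.
Qed.

Lemma is_diff_bop E F (T : bop E F) x : is_diff x T T.
Proof.
apply/is_diffP => e e0; exists 1 => // h _.
by rewrite linearD (addrC (T x)) addrK subrr normr0 mulr_ge0// ltW.
Qed.

Lemma is_diff_const E F (c : F) (x : E) :
  is_diff x (fun=> c) (0 : bop E F).
Proof.
apply/is_diffP => e e0; exists 1 => // h _.
by rewrite subrr bop_zeroE subrr normr0 mulr_ge0// ltW.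
Qed.

Lemma is_diff_add E F (f g : E -> F) x (Lf Lg : bop E F) :
  is_diff x f Lf -> is_diff x g Lg ->
  is_diff x (fun y => f y + g y) (Lf + Lg).
Proof.
move=> /is_diffP df /is_diffP dg; apply/is_diffP => e e0.
have [d d0 dP] := df (e / 2) (divr_gt0 e0 (ltr0n _ 2)).
have [r r0 rP] := dg (e / 2) (divr_gt0 e0 (ltr0n _ 2)).
exists (Num.min d r) => [|h]; first by rewrite lt_min d0.
rewrite lt_min => /andP[/dP h1 /rP h2]; rewrite bop_addE.
rewrite (_ : _ - _ - _ = (f (x + h) - f x - Lf h) + (g (x + h) - g x - Lg h)).
  by apply: le_trans (ler_normD _ _) _; rewrite (splitr e) mulrDl lerD.
by rewrite [RHS]addrACA [X in _ = X + _]addrACA !opprD.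
Qed.

Lemma is_diff_comp_bop E F G (f : E -> F) (g : F -> G) x
    (Lf : bop E F) (Lg : bop F G) :
  is_diff x f Lf -> is_diff (f x) g Lg ->
  is_diff x (fun y => g (f y)) (bcomp Lg Lf).
Proof. by move=> df dg; exact: is_diff_comp df dg. Qed.

Lemma continuous_bilin E (E1 E2 : normedModType R) F (B : bop E1 (bop E2 F))
    (f : E -> E1) (g : E -> E2) x :
  {for x, continuous f} -> {for x, continuous g} ->
  {for x, continuous (fun y => B (f y) (g y))}.
Proof.
move=> /continuousP_eps fc /continuousP_eps gc; apply/continuousP_eps => e e0.
pose c := `|B| * (`|g x| + 1 + `|f x|) + 1.
have c0 : 0 < c.
  by apply: ltr_wpDl => //; apply: mulr_ge0 => //; do 2 apply: addr_ge0 => //.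
pose e' := Num.min (e / c) 1.
have e'0 : 0 < e' by rewrite lt_min divr_gt0 ?ltr01.
have [d d0 dP] := fc e' e'0; have [r r0 rP] := gc e' e'0.
exists (Num.min d r) => [|h]; first by rewrite lt_min d0.
rewrite lt_min => /andP[/dP h1 /rP h2].
have -> : B (f (x + h)) (g (x + h)) - B (f x) (g x) =
    B (f (x + h) - f x) (g (x + h)) + B (f x) (g (x + h) - g x).
  by rewrite (linearB B) (linearB (B (f x))) bop_subE addrA subrK.
have gb : `|g (x + h)| <= `|g x| + 1.
  rewrite -[g (x + h)](subrK (g x)) addrC (le_trans (ler_normD _ _))// lerD//.
  by apply: le_trans h2 _; rewrite ge_min lexx orbT.
apply: (@le_trans _ _ (`|B| * e' * (`|g x| + 1) + `|B| * `|f x| * e')).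
  apply: le_trans (ler_normD _ _) _; apply: lerD.
    by apply: le_trans (norm_bop_apply2 _ _ _) _; rewrite !ler_pM// mulr_ge0.
  by apply: le_trans (norm_bop_apply2 _ _ _) _; rewrite !ler_pM// mulr_ge0.
apply: (@le_trans _ _ (e' * c)); first by rewrite /c; nra.
by rewrite -ler_pdivlMr// /e' ge_min lexx.
Qed.

(** [L] is specified by its values, so that each caller can give it the form that suits its
    induction, such as [bilin_left] plus [bilin_right]. *)
Lemma is_diff_bilin E (E1 E2 : normedModType R) F (B : bop E1 (bop E2 F)) (f :
  E -> E1)
    (g : E -> E2) x (Lf : bop E E1) (Lg : bop E E2) (L : bop E F) :
  is_diff x f Lf -> is_diff x g Lg ->
  (forall h, L h = B (Lf h) (g x) + B (f x) (Lg h)) ->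
  is_diff x (fun y => B (f y) (g y)) L.
Proof.
move=> df dg LE; apply/is_diffP => e e0.
pose c := `|B| * (`|g x| + 1 + `|f x| + `|Lf|) + 1.
have c0 : 0 < c.
  by apply: ltr_wpDl => //; apply: mulr_ge0 => //; do 3 apply: addr_ge0 => //.
pose e' := Num.min (e / c) 1.
have e'0 : 0 < e' by rewrite lt_min divr_gt0 ?ltr01.
have [d d0 dP] := (is_diffP _ _ _).1 df e' e'0.
have [r r0 rP] := (is_diffP _ _ _).1 dg e' e'0.
have [s s0 sP] := (continuousP_eps _ _).1 (is_diff_continuous dg) e' e'0.
exists (Num.min d (Num.min r s)) => [|h]; first by rewrite !lt_min d0 r0.
rewrite !lt_min => /and3P[/dP h1 /rP h2 /sP h3]; rewrite LE.
(* The error splits into the remainder of [f], the remainder of [g], and a mixed term that is small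
   by continuity of [g]. The constant [c] collects their coefficients, and [e' <= 1] bounds
   [g (x + h)]. *)
have -> : B (f (x + h)) (g (x + h)) - B (f x) (g x) -
    (B (Lf h) (g x) + B (f x) (Lg h)) =
    B (f (x + h) - f x - Lf h) (g (x + h)) +
    B (f x) (g (x + h) - g x - Lg h) + B (Lf h) (g (x + h) - g x).
  set b := g (x + h); rewrite (linearB (B (Lf h))) !(linearB (B (f x))).
  rewrite !(linearB B) !bop_subE.
  rewrite [X in _ = X + _]addrACA [X in _ = X + _ + _]addrA subrK -[RHS]addrA.
  congr (_ + _).
  by rewrite addrACA addNr add0r -opprD addrC.
have gb : `|g (x + h)| <= `|g x| + 1.
  rewrite -[g (x + h)](subrK (g x)) addrC (le_trans (ler_normD _ _))// lerD//.
  by apply: le_trans h3 _; rewrite ge_min lexx orbT.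
apply: (@le_trans _ _ (`|B| * (e' * `|h|) * (`|g x| + 1) +
   `|B| * `|f x| * (e' * `|h|) + `|B| * (`|Lf| * `|h|) * e')).
  apply: le_trans (ler_normD _ _) _; apply: lerD.
    apply: le_trans (ler_normD _ _) _; apply: lerD.
      by apply: le_trans (norm_bop_apply2 _ _ _) _; rewrite !ler_pM// mulr_ge0.
    by apply: le_trans (norm_bop_apply2 _ _ _) _; rewrite !ler_pM// mulr_ge0.
  apply: le_trans (norm_bop_apply2 _ _ _) _; rewrite !ler_pM// ?mulr_ge0//.
  exact: norm_bop_apply.
apply: (@le_trans _ _ (e' * c * `|h|)).
  have := normr_ge0 h; have := normr_ge0 B; have := normr_ge0 (f x).
  have := normr_ge0 (g x); have := normr_ge0 Lf.
  move=> L0 g0 f0 B0 h0.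
  rewrite /c; have : 0 <= e' * `|h| by rewrite mulr_ge0// ltW.
  by nra.
by rewrite ler_wpM2r// -ler_pdivlMr// /e' ge_min lexx.
Qed.

End DiffEps.

Section CnBasics.
Context {R : realType}.
Implicit Types E F G : normedModType R.

Lemma Cn_on_sub n E F (U W : set E) (f : E -> F) :
  U `<=` W -> Cn_on n W f -> Cn_on n U f.
Proof.
elim: n F f => [|n IHn] F f UW /=; first by move=> fc x /UW; exact: fc.
by move=> [Df [dD CD]]; exists Df; split; [move=> x /UW; exact: dD|exact: IHn].
Qed.

Lemma Cn_onS n E F (U : set E) (f : E -> F) : Cn_on n.+1 U f -> Cn_on n U f.
Proof.
elim: n F f => [|n IHn] F f; first by move=> [Df [dD _]] x Ux;
  exact: is_diff_continuous (dD x Ux).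
by move=> [Df [dD CD]]; exists Df; split=> //; exact: IHn.
Qed.

Lemma Cn_on_continuous n E F (U : set E) (f : E -> F) x :
  Cn_on n U f -> U x -> {for x, continuous f}.
Proof.
elim: n F f => [|n IHn] F f; first by move=> fc Ux; exact: fc.
by move=> /Cn_onS; exact: IHn.
Qed.

Lemma Cn_on_const n E F (U : set E) (c : F) : Cn_on n U (fun=> c).
Proof.
elim: n F c => [|n IHn] F c; first by move=> x _; exact: cst_continuous.
by exists (fun=> 0); split; [move=> x _; exact: is_diff_const|exact: IHn].
Qed.

Lemma Cn_on_bop n E F (U : set E) (T : bop E F) : Cn_on n U T.
Proof.
case: n => [|n]; first by move=> x _; exact: bop_continuous.
exists (fun=> T); split; [move=> x _; exact: is_diff_bop|exact: Cn_on_const].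
Qed.

Lemma Cn_on_add n E F (U : set E) (f g : E -> F) :
  Cn_on n U f -> Cn_on n U g -> Cn_on n U (fun x => f x + g x).
Proof.
elim: n F f g => [|n IHn] F f g.
  by move=> fc gc x Ux; apply: continuousD; [exact: fc|exact: gc].
move=> [Df [dD CD]] [Dg [dG CG]]; exists (fun x => Df x + Dg x).
by split; [move=> x Ux; apply: is_diff_add; auto|exact: IHn].
Qed.

(** With [bilin_right], it expresses the derivative of B(f, g) as a sum of two bounded bilinear maps
    applied to (Df, g) and (f, Dg). Products of class C^n can thus be treated by induction on n for
    all [B] at once. *)
Definition bilin_left E (E1 E2 : normedModType R) F (B : bop E1 (bop E2 F)) :
  bop (bop E E1) (bop E2 (bop E F)).
Proof.
apply: (@bilin_bop _ _ _ _
  (fun T y => bcomp (eval_bop F y) (bcomp B T)) `|B|).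
- by move=> y a S T; apply: bop_eq => x; rewrite /= linearP.
- by move=> T a y z; apply: bop_eq => x; rewrite /= linearP.
- move=> T y; apply: norm_bop_le => [|x]; first by rewrite !mulr_ge0.
  apply: le_trans (norm_bop_apply2 B _ _) _.
  rewrite -!mulrA ler_wpM2l// [leRHS]mulrCA mulrC ler_wpM2l//.
  exact: norm_bop_apply.
Defined.

Definition bilin_right E (E1 E2 : normedModType R) F (B : bop E1 (bop E2 F)) :
  bop E1 (bop (bop E E2) (bop E F)) := bcomp (comp_bop E E2 F) B.

Lemma bilin_leftE E (E1 E2 : normedModType R) F (B : bop E1 (bop E2 F)) (T :
  bop E E1) y h :
  bilin_left E B T y h = B (T h) y.
Proof. by []. Qed.

Lemma bilin_rightE E (E1 E2 : normedModType R) F (B : bop E1 (bop E2 F)) x (T :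
  bop E E2) h :
  bilin_right E B x T h = B x (T h).
Proof. by []. Qed.

Lemma Cn_on_bilin n E (E1 E2 : normedModType R) F (U : set E) (B : bop E1 (bop
  E2 F))
    (f : E -> E1) (g : E -> E2) :
  Cn_on n U f -> Cn_on n U g -> Cn_on n U (fun x => B (f x) (g x)).
Proof.
elim: n E1 E2 F B f g => [|n IHn] E1 E2 F B f g.
  by move=> fc gc x Ux; apply: continuous_bilin; [exact: fc|exact: gc].
move=> fS gS; have fn := Cn_onS fS; have gn := Cn_onS gS.
have [Df [dD CD]] := fS; have [Dg [dG CG]] := gS.
exists (fun x => bilin_left E B (Df x) (g x) + bilin_right E B (f x) (Dg x)).
split=> [x Ux|].
  by apply: is_diff_bilin (dD x Ux) (dG x Ux) _ => h; rewrite bop_addE.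
by apply: Cn_on_add; apply: IHn.
Qed.

(** The derivative is a composition, hence a bounded bilinear expression in Dg(f x) and Df x; the
    first is of class C^n by induction, so [Cn_on_bilin] concludes. *)
Lemma Cn_on_comp n E F G (U : set E) (W : set F) (f : E -> F) (g : F -> G) :
  (forall x, U x -> W (f x)) -> Cn_on n U f -> Cn_on n W g ->
  Cn_on n U (fun x => g (f x)).
Proof.
elim: n G g => [|n IHn] G g UW.
  move=> fc gc x Ux; apply: (@continuous_comp _ _ _ f g); first exact: fc.
  exact/gc/UW.
move=> fS [Dg [dG CG]]; have [Df [dD CD]] := fS.
exists (fun x => comp_bop E F G (Dg (f x)) (Df x)); split=> [x Ux|].
  by apply: is_diff_comp_bop; [exact: dD|exact/dG/UW].
by apply: Cn_on_bilin => //; apply: IHn => //; exact: Cn_onS.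
Qed.

End CnBasics.

(** * Smoothness of inversion *)

Section Inverse.
Context {R : realType}.

Section Algebra.
Context {V : normedModType R}.
Implicit Types g h : bop V V.

Lemma opinvP g : GL V g -> g * opinv g = 1 /\ opinv g * g = 1.
Proof. by move=> gG; have := xgetPex 0 gG. Qed.

Lemma GL_mul g h : GL V g -> GL V h -> GL V (g * h).
Proof.
move=> [g' [gg' g'g]] [h' [hh' h'h]]; exists (h' * g'); split.
  by rewrite -mulrA (mulrA h) hh' mul1r.
by rewrite -mulrA (mulrA g') g'g mul1r.
Qed.

Lemma GL_one : GL V 1.
Proof. by exists 1; rewrite mulr1. Qed.

Lemma GL_opinv g : GL V g -> GL V (opinv g).
Proof. by move=> /opinvP[gi ig]; exists g. Qed.

Lemma opinv_sub g h : GL V g -> GL V h ->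
  opinv h - opinv g = - (opinv h * (h - g) * opinv g).
Proof.
move=> /opinvP[gi _] /opinvP[_ ih].
by rewrite mulrBr mulrBl ih mul1r -mulrA gi mulr1 opprB.
Qed.

Definition inv_deriv_bop : bop (bop V V) (bop (bop V V) (bop (bop V V) (bop V
  V))).
Proof.
apply: (@bilin_bop _ _ _ _
  (fun a b => - bcomp (lmul_bop a) (rmul_bop b)) 1).
- move=> b c a a'; apply: bop_eq => h.
  rewrite bop_addE bop_scaleE !bop_oppE.
  rewrite !(_ : forall d, bcomp (lmul_bop d) (rmul_bop b) h = d * (h * b));
    try by move=> d; exact: lmul_bopE.
  by rewrite mulrDl bop_scalerAl opprD scalerN.
- move=> a c b b'; apply: bop_eq => h.
  rewrite bop_addE bop_scaleE !bop_oppE.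
  rewrite !(_ : forall d, bcomp (lmul_bop a) (rmul_bop d) h = a * (h * d));
    try by move=> d; exact: lmul_bopE.
  by rewrite mulrDr bop_scalerAr mulrDr bop_scalerAr opprD scalerN.
- move=> a b; rewrite normrN mul1r; apply: norm_bop_le;
    first by rewrite mulr_ge0.
  move=> h; rewrite [X in `|X|](_ : _ = a * (h * b)); last exact: lmul_bopE.
  apply: le_trans (norm_bop_mul _ _) _; rewrite -mulrA ler_wpM2l// mulrC.
  exact: norm_bop_mul.
Defined.

Lemma inv_deriv_bopE a b h : inv_deriv_bop a b h = - (a * (h * b)).
Proof. by rewrite [LHS]bop_oppE; congr (- _); exact: lmul_bopE. Qed.

End Algebra.

Context {V : completeNormedModType R}.
Implicit Types g h x : bop V V.

Lemma GL_one_sub x : `|x| < 1 -> GL V (1 - x).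
Proof.
move=> x1; pose u (n : nat) := x ^+ n.
have cu : cvgn (series u).
  apply: (series_dom_cvg (v := geometric 1 `|x|)) => [n|].
    by rewrite /geometric /= mul1r norm_bop_exp.
  by apply: is_cvg_geometric_series; rewrite ger0_norm.
have x0 : u @ \oo --> 0 by exact: cvg_series_cvg_0.
have s0 : series u 0 = 0 by rewrite seriesEord /= big_ord0.
have sS n : series u n.+1 = series u n + x ^+ n.
  by rewrite !seriesEord /= big_ord_recr.
have eL n : (1 - x) * series u n = 1 - x ^+ n.
  elim: n => [|n IHn]; first by rewrite s0 mulr0 expr0 subrr.
  by rewrite sS mulrDr IHn mulrBl mul1r -exprS addrA subrK.
have eR n : series u n * (1 - x) = 1 - x ^+ n.
  elim: n => [|n IHn]; first by rewrite s0 mul0r expr0 subrr.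
  by rewrite sS mulrDl IHn mulrBr mulr1 -exprSr addrA subrK.
have l1 : (fun n => 1 - x ^+ n) @ \oo --> (1 : bop V V).
  by rewrite -[X in _ --> X]subr0; apply: cvgB; [exact: cvg_cst|exact: x0].
exists (limn (series u)); split.
  have cL : (fun n => (1 - x) * series u n) @ \oo --> (1 - x) * limn (series u).
    by apply: mul_bop_cvg; [exact: cvg_cst|exact: cu].
  have <- := cvg_lim (@norm_hausdorff _ _) cL.
  by rewrite (funext eL); exact: cvg_lim.
have cR : (fun n => series u n * (1 - x)) @ \oo --> limn (series u) * (1 - x).
  by apply: mul_bop_cvg; [exact: cu|exact: cvg_cst].
have <- := cvg_lim (@norm_hausdorff _ _) cR.
by rewrite (funext eR); exact: cvg_lim.
Qed.

Lemma GL_perturb g h : GL V g -> `|h| * `|opinv g| < 1 -> GL V (g + h).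
Proof.
move=> gG hlt; have [gi ig] := opinvP gG.
have -> : g + h = g * (1 - (- (opinv g * h))).
  by rewrite opprK mulrDr mulr1 mulrA gi mul1r.
apply: GL_mul => //; apply: GL_one_sub; rewrite normrN.
by apply: le_lt_trans (norm_bop_mul _ _) _; rewrite mulrC.
Qed.

Lemma is_diff_opinv g : GL V g ->
  is_diff g (@opinv R V) (inv_deriv_bop (opinv g) (opinv g)).
Proof.
move=> gG; apply/is_diffP => e e0; set a := opinv g.
(* With a = g^-1 and b = (g + h)^-1, the remainder is b h a h a. The radius below gives |h| |a| <=
   1/2, hence |b| <= 2 |a|, so the remainder is at most 2 |a|^3 |h|^2. *)
pose c := 2 * `|a| ^+ 3 + 1.
have c0 : 0 < c by rewrite ltr_wpDl// mulr_ge0// exprn_ge0.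
have a1 : 0 < 2 * `|a| + 1 by rewrite ltr_wpDl// mulr_ge0.
exists (Num.min (2 * `|a| + 1)^-1 (e / c)) => [|h].
  by rewrite lt_min invr_gt0 a1 divr_gt0.
rewrite lt_min => /andP[ha hc].
have ha2 : `|h| * `|a| <= 1 / 2.
  move: ha; rewrite -[_^-1]mul1r ltr_pdivlMr//.
  by have := normr_ge0 h; have := normr_ge0 a; nra.
have ghG : GL V (g + h).
  by apply: GL_perturb => //; apply: le_lt_trans ha2 _; lra.
set b := opinv (g + h).
have ba : b - a = - (b * h * a) by rewrite opinv_sub// addrAC subrr add0r.
have b_le : `|b| <= 2 * `|a|.
  have : `|b| <= `|a| + `|b| * (`|h| * `|a|).
    rewrite -{1}[b](subrK a) ba addrC (le_trans (ler_normD _ _))// lerD//.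
    rewrite normrN mulrA (le_trans (norm_bop_mul _ _))// ler_wpM2r//.
    exact: norm_bop_mul.
  by have := normr_ge0 b; nra.
have -> : b - a - inv_deriv_bop a a h = b * h * (a * h * a).
  have bha : b * h * a = a - b by rewrite -[RHS]opprB ba opprK.
  rewrite inv_deriv_bopE opprK ba -[a * h * a]mulrA [RHS]mulrA [in RHS]bha.
  by rewrite mulrBl addrC (mulrA b).
apply: (@le_trans _ _ (2 * `|a| * `|h| * (`|a| * `|h| * `|a|))).
  apply: le_trans (norm_bop_mul _ _) _; apply: ler_pM => //.
    by apply: le_trans (norm_bop_mul _ _) _; rewrite ler_wpM2r.
  apply: le_trans (norm_bop_mul _ _) _; rewrite ler_wpM2r//.
  exact: norm_bop_mul.
rewrite (_ : _ * _ = 2 * `|a| ^+ 3 * `|h| * `|h|); last by ring.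
rewrite ler_wpM2r//; move: hc; rewrite ltr_pdivlMr// => /ltW; apply: le_trans.
by rewrite mulrC ler_wpM2l// lerDl.
Qed.

(** The derivative of inversion is a bounded bilinear expression in inversion itself, so class C^n
    bootstraps to C^(n+1). *)
Lemma Cn_on_opinv n : Cn_on n (GL V) (@opinv R V).
Proof.
elim: n => [|n IHn].
  by move=> g gG; exact: is_diff_continuous (is_diff_opinv gG).
exists (fun g => inv_deriv_bop (opinv g) (opinv g)).
by split; [exact: is_diff_opinv|exact: Cn_on_bilin].
Qed.

End Inverse.

(** * Smoothness through an isometry onto a closed subspace *)

Section IsometryLift.
Context {R : realType}.

Lemma isometry_range_closed (M : completeNormedModType R) (F : normedModType R)
    (j : bop M F) y :
  (forall m, `|j m| = `|m|) ->
  (forall e : R, 0 < e -> exists m, `|j m - y| <= e) -> exists m, j m = y.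
Proof.
move=> jI ye.
have /choice[u uP] : forall k : nat, exists m, `|j m - y| <= k.+1%:R^-1.
  by move=> k; apply: ye; rewrite invr_gt0.
have cu : cvg (u @ \oo).
  apply/cauchy_cvgP/cauchy_exP => e e0.
  have [k ke] : exists k : nat, 2 / e < k.+1%:R.
    have /archi_boundP := divr_ge0 (ler0n R 2) (ltW e0) => ?.
    exists (Num.bound (2 / e)); rewrite (lt_trans (_ : _ < (Num.bound (2 /
      e))%:R))//.
    by rewrite ltr_nat.
  exists (u k); exists k => // n /= kn; rewrite -ball_normE /= -jI bopB.
  rewrite (_ : _ - _ = (j (u k) - y) - (j (u n) - y)); last first.
    by rewrite opprB addrA subrK.
  apply: le_lt_trans (ler_normB _ _) _.
  apply: (@le_lt_trans _ _ (k.+1%:R^-1 + k.+1%:R^-1)).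
    rewrite lerD// (le_trans (uP n))// lef_pV2 ?posrE// ler_nat ltnS//.
  have k0 : 0 < k.+1%:R :> R by [].
  move: ke; rewrite ltr_pdivrMr// => ke.
  rewrite (_ : _ + _ = 2 / k.+1%:R); last by ring.
  by rewrite ltr_pdivrMr// mulrC.
exists (lim (u @ \oo)); apply: (@cvg_unique _ (@norm_hausdorff _ F) (j \o u @
  \oo)).
  exact: bop_cvg cu.
apply/cvgrPdist_le => e e0.
have [k ke] : exists k : nat, e^-1 < k.+1%:R.
  have /archi_boundP : 0 <= e^-1 by rewrite invr_ge0 ltW.
  move=> be; exists (Num.bound e^-1); apply: lt_trans be _.
  by rewrite ltr_nat.
exists k => // n /= kn; rewrite distrC (le_trans (uP n))//.
rewrite (@le_trans _ _ k.+1%:R^-1)//; first by rewrite lef_pV2 ?posrE// ler_nat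
  ltnS.
by rewrite -[e]invrK lef_pV2 ?posrE ?invr_gt0// ltW.
Qed.

Lemma isometry_comp (E M F : normedModType R) (j : bop M F) :
  (forall m, `|j m| = `|m|) ->
  forall T, `|comp_bop E M F j T| = `|T|.
Proof.
move=> jI T; apply/eqP; rewrite eq_le; apply/andP; split.
  by apply: norm_bop_le => // x; rewrite [X in `|X|](_ : _ = j (T x))// jI
    norm_bop_apply.
apply: norm_bop_le => // x; rewrite -jI.
exact: (norm_bop_apply (comp_bop E M F j T)).
Qed.

(** The directional derivatives of [g] are limits of difference quotients lying in the range of [j],
    which is closed because [M] is complete; so [Dg x] factors through [j]. The induction replaces
    [j] by postcomposition with [j], again an isometry, now out of [bop E M]: this is where
    completeness of operator spaces enters. *)
Lemma Cn_on_lift n (E : normedModType R) (M : completeNormedModType R)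
    (F : normedModType R) (j : bop M F) (U : set E) (f : E -> M) (g : E -> F) :
  (forall m, `|j m| = `|m|) -> open U ->
  (forall x, U x -> j (f x) = g x) -> Cn_on n U g -> Cn_on n U f.
Proof.
move=> + Uo; elim: n M F j f g => [|n IHn] M F j f g jI fg.
  move=> gc x Ux; apply/continuousP_eps => e e0.
  have [d d0 dP] := (continuousP_eps _ _).1 (gc x Ux) e e0.
  have /nbhs_ballP[r r0 rU] : nbhs x U by exact: open_nbhs_nbhs.
  exists (Num.min d r) => [|h]; first by rewrite lt_min d0.
  rewrite lt_min => /andP[hd hr].
  rewrite -jI bopB !fg//; first exact: dP.
  by apply: rU; rewrite -ball_normE /= opprD addNKr normrN.
move=> [Dg [dD CD]].
have /choice[Df DfP] : forall x, exists T : bop E M,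
    U x -> forall h, j (T h) = Dg x h.
  move=> x; have [Ux|nUx] := pselect (U x); last by exists 0.
  have jinj a b : j a = j b -> a = b.
    move=> /eqP; rewrite -subr_eq0 -linearB -normr_eq0 jI normr_eq0 subr_eq0.
    by move/eqP.
  have /choice[T TP] : forall h, exists m, j m = Dg x h.
    move=> h; apply: isometry_range_closed => // e e0.
    have h1 : 0 < `|h| + 1 by rewrite ltr_wpDl.
    have [d d0 dP] := (is_diffP _ _ _).1 (dD x Ux) (e / (`|h| + 1)) (divr_gt0
      e0 h1).
    have /nbhs_ballP[r r0 rU] : nbhs x U by exact: open_nbhs_nbhs.
    pose t := Num.min d r / (`|h| + 1) / 2.
    have t0 : 0 < t by rewrite !divr_gt0// lt_min d0.
    have th : `|t *: h| < Num.min d r.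
      have m0 : 0 < Num.min d r by rewrite lt_min d0.
      rewrite normrZ gtr0_norm//.
      apply: (@le_lt_trans _ _ (t * (`|h| + 1))).
        by rewrite ler_wpM2l ?lerDl// ltW.
      by rewrite /t mulrAC divfK ?gt_eqF// ltr_pdivrMr// ltr_pMr// ltr1n.
    (* [j] maps this vector to the difference quotient of [g] with step [t], which is within [e] of
       [Dg x h]. *)
    exists (t^-1 *: (f (x + t *: h) - f x)).
    have [thd thr] : `|t *: h| < d /\ `|t *: h| < r.
      by move: th; rewrite lt_min => /andP.
    rewrite bopZ bopB !fg//; last first.
      by apply: rU; rewrite -ball_normE /= opprD addNKr normrN.
    have -> : t^-1 *: (g (x + t *: h) - g x) - Dg x h =
        t^-1 *: (g (x + t *: h) - g x - Dg x (t *: h)).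
      rewrite [RHS]scalerBr bopZ [X in _ = _ - X]scalerA.
      by rewrite mulVf ?gt_eqF// scale1r.
    rewrite normrZ gtr0_norm ?invr_gt0// mulrC ler_pdivrMr//.
    apply: le_trans (dP _ thd) _; rewrite normrZ gtr0_norm//.
    rewrite mulrCA [leRHS]mulrC; apply: ler_wpM2l; first exact: ltW.
    rewrite mulrAC ler_pdivrMr//; apply: ler_wpM2l; first exact: ltW.
    by rewrite lerDl.
  have Tb : bounded_operator T.
    split=> [a b c|]; first by apply: jinj;
      rewrite [RHS]bopD bopZ !TP bopD bopZ.
    by exists `|Dg x| => h; rewrite -jI TP norm_bop_apply.
  by exists (mkbop Tb).
exists Df; split=> [x Ux|].
  apply/is_diffP => e e0.
  have [d d0 dP] := (is_diffP _ _ _).1 (dD x Ux) e e0.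
  have /nbhs_ballP[r r0 rU] : nbhs x U by exact: open_nbhs_nbhs.
  exists (Num.min d r) => [|h]; first by rewrite lt_min d0.
  rewrite lt_min => /andP[hd hr].
  rewrite -jI !bopB DfP// !fg//; first exact: dP.
  by apply: rU; rewrite -ball_normE /= opprD addNKr normrN.
apply: (IHn _ _ (comp_bop E M F j) Df Dg) => //; first exact: isometry_comp.
by move=> x Ux; apply: bop_eq => h; exact: DfP.
Qed.

End IsometryLift.

(** * Power series *)

Section DominatedDerivatives.
Context {R : realType}.
Implicit Types E F : normedModType R.

(* On the ball of radius [r], [p] is bounded by [w] and each of its first [k]
   derivatives costs at most a factor [l]; for a homogeneous polynomial of
   degree n one takes l = n / r. *)
Fixpoint deriv_bounded (k : nat) E F (r l w : R) (p : E -> F) : Prop :=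
  (forall x, `|x| < r -> `|p x| <= w) /\
  match k with
  | 0 => True
  | m.+1 => exists Dp : E -> bop E F,
      [/\ forall x y, `|x| < r -> `|y| < r ->
            `|p y - p x| <= l * w * `|y - x|,
          forall x y, `|x| < r -> `|y| < r ->
            `|p y - p x - Dp x (y - x)| <= l ^+ 2 * w * `|y - x| ^+ 2 &
          deriv_bounded m r l (l * w) Dp]
  end.

Lemma deriv_bounded_le k E F r l w (p : E -> F) x :
  deriv_bounded k r l w p -> `|x| < r -> `|p x| <= w.
Proof. by case: k => [|k] [pw _]; exact: pw. Qed.

Lemma deriv_boundedS k E F r l w (p : E -> F) :
  deriv_bounded k.+1 r l w p -> deriv_bounded k r l w p.
Proof.
elim: k F w p => [|k IHk] F w p; first by case.
move=> [pw [Dp [lip tay Dpb]]]; split=> //.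
by exists Dp; split=> //; exact: IHk.
Qed.

Lemma deriv_bounded_const k E F r l w (c : F) : 0 <= l -> 0 <= w ->
  `|c| <= w -> deriv_bounded k r l w (fun _ : E => c).
Proof.
elim: k F w c => [|k IHk] F w c l0 w0 cw; first by split.
split=> //; exists (fun=> 0); split=> [x y _ _|x y _ _|].
- by rewrite subrr normr0 !mulr_ge0.
- by rewrite subrr bop_zeroE subrr normr0 !mulr_ge0 ?exprn_ge0.
- by apply: IHk => //; rewrite ?normr0 mulr_ge0.
Qed.

Lemma deriv_bounded_id k E r : 0 < r ->
  deriv_bounded k r r^-1 r (fun x : E => x).
Proof.
move=> r0; have rr : r^-1 * r = 1 by rewrite mulVf// gt_eqF.
case: k => [|k]; first by split=> // x /ltW.
split=> [x /ltW//|]; exists (fun=> 1); split=> [x y _ _|x y _ _|].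
- by rewrite rr mul1r.
- by rewrite bop_oneE subrr normr0 !mulr_ge0 ?exprn_ge0 ?invr_ge0// ltW.
- rewrite rr; apply: deriv_bounded_const => //; last exact: norm_bop_one.
  by rewrite invr_ge0 ltW.
Qed.

Lemma deriv_bounded_add k E F r l w v (p q : E -> F) :
  deriv_bounded k r l w p -> deriv_bounded k r l v q ->
  deriv_bounded k r l (w + v) (fun x => p x + q x).
Proof.
elim: k F w v p q => [|k IHk] F w v p q.
  move=> [pw _] [qv _]; split=> // x xr.
  by apply: le_trans (ler_normD _ _) _; rewrite lerD// ?pw// qv.
move=> [pw [Dp [plip ptay Dpb]]] [qv [Dq [qlip qtay Dqb]]]; split.
  by move=> x xr; apply: le_trans (ler_normD _ _) _; rewrite lerD// ?pw// qv.
exists (fun x => Dp x + Dq x); split=> [x y xr yr|x y xr yr|].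
- rewrite opprD addrACA mulrDr mulrDl.
  by apply: le_trans (ler_normD _ _) _; rewrite lerD// ?plip// qlip.
- rewrite (_ : _ - _ - _ = (p y - p x - Dp x (y - x)) + (q y - q x - Dq x (y -
    x))).
    rewrite mulrDr mulrDl.
    by apply: le_trans (ler_normD _ _) _; rewrite lerD// ?ptay// qtay.
  by rewrite bop_addE [RHS]addrACA [X in _ = X + _]addrACA !opprD.
- by rewrite mulrDr; exact: IHk.
Qed.

Lemma deriv_bounded_scale k E F r l w a (p : E -> F) :
  deriv_bounded k r l w p ->
  deriv_bounded k r l (`|a| * w) (fun x => a *: p x).
Proof.
elim: k F w p => [|k IHk] F w p.
  by move=> [pw _]; split=> // x xr; rewrite normrZ ler_wpM2l// pw.
move=> [pw [Dp [lip tay Dpb]]]; split.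
  by move=> x xr; rewrite normrZ ler_wpM2l// pw.
exists (fun x => a *: Dp x); split=> [x y xr yr|x y xr yr|].
- rewrite -scalerBr normrZ (_ : l * _ * _ = `|a| * (l * w * `|y - x|)).
    by rewrite ler_wpM2l// lip.
  by ring.
- rewrite bop_scaleE -!scalerBr normrZ.
  rewrite (_ : l ^+ 2 * _ * _ = `|a| * (l ^+ 2 * w * `|y - x| ^+ 2)).
    by rewrite ler_wpM2l// tay.
  by ring.
- by rewrite mulrCA; exact: IHk.
Qed.

Lemma norm_bilin_left E (E1 E2 : normedModType R) F (B : bop E1 (bop E2 F)) :
  `|bilin_left E B| <= `|B|.
Proof. exact: norm_bilin_bop. Qed.

Lemma norm_bilin_right E (E1 E2 : normedModType R) F (B : bop E1 (bop E2 F)) :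
  `|bilin_right E B| <= `|B|.
Proof.
apply: norm_bop_le => // x; apply: le_trans (norm_bop_apply B x).
exact: norm_comp_bop.
Qed.

(** Rates add and weights multiply, because (l + m) w v = (l w) v + w (m v) is the Leibniz rule. The
    bound [|B| <= 1] keeps constants from accumulating when powers are built one factor at a
    time. *)
Lemma deriv_bounded_bilin k E (E1 E2 : normedModType R) F
    (B : bop E1 (bop E2 F)) r l m w v (p : E -> E1) (q : E -> E2) :
  `|B| <= 1 -> 0 <= l -> 0 <= m -> 0 <= w -> 0 <= v ->
  deriv_bounded k r l w p -> deriv_bounded k r m v q ->
  deriv_bounded k r (l + m) (w * v) (fun x => B (p x) (q x)).
Proof.
move=> + l0 m0.
have Ble (G1 G2 G : normedModType R) (C : bop G1 (bop G2 G)) x y a b : `|C| <=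
  1 ->
    `|x| <= a -> `|y| <= b -> `|C x y| <= a * b.
  move=> C1 xa yb; apply: le_trans (norm_bop_apply2 _ _ _) _.
  rewrite ler_pM// ?mulr_ge0//; apply: le_trans xa.
  by rewrite ler_piMl.
elim: k E1 E2 F B w v p q => [|k IHk] E1 E2 F B w v p q B1 w0 v0 pb qb.
  by split=> // x xr; apply: Ble => //; [exact: pb.1|exact: qb.1].
have pb' := deriv_boundedS pb; have qb' := deriv_boundedS qb.
move: pb qb => [pw [Dp [plip ptay Dpb]]] [qv [Dq [qlip qtay Dqb]]].
split; first by move=> x xr; apply: Ble => //; [exact: pw|exact: qv].
exists (fun x => bilin_left E B (Dp x) (q x) + bilin_right E B (p x) (Dq x)).
split=> [x y xr yr|x y xr yr|].
- rewrite (_ : _ - _ = B (p y - p x) (q y) + B (p x) (q y - q x)); last first.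
    by rewrite (bopB B) (bopB (B (p x))) bop_subE addrA subrK.
  apply: le_trans (ler_normD _ _) _.
  apply: (@le_trans _ _ (l * w * `|y - x| * v + w * (m * v * `|y - x|))).
    by apply: lerD; apply: Ble => //; [exact: plip|exact: qv|exact: pw|exact:
      qlip].
  by rewrite le_eqVlt; apply/orP; left; apply/eqP; ring.
- set h := y - x; rewrite bop_addE bilin_leftE bilin_rightE.
  have -> : B (p y) (q y) - B (p x) (q x) - (B (Dp x h) (q x) + B (p x) (Dq x
    h)) =
      B (p y - p x - Dp x h) (q y) + B (p x) (q y - q x - Dq x h) +
      B (Dp x h) (q y - q x).
    rewrite (bopB (B (Dp x h))) !(bopB (B (p x))) !(bopB B) !bop_subE.
    rewrite [X in _ = X + _]addrACA [X in _ = X + _ + _]addrA subrK -[RHS]addrA.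
    by congr (_ + _); rewrite addrACA addNr add0r -opprD addrC.
  have Dph : `|Dp x h| <= l * w * `|h|.
    apply: le_trans (norm_bop_apply _ _) _; rewrite ler_wpM2r//.
    exact: deriv_bounded_le Dpb xr.
  apply: (@le_trans _ _ (l ^+ 2 * w * `|h| ^+ 2 * v + w * (m ^+ 2 * v * `|h| ^+
    2)
     + (l * w * `|h|) * (m * v * `|h|))).
    apply: le_trans (ler_normD _ _) _; apply: lerD.
      apply: le_trans (ler_normD _ _) _; apply: lerD.
        by apply: Ble => //; [exact: ptay|exact: qv].
      by apply: Ble => //; [exact: pw|exact: qtay].
    by apply: Ble => //; exact: qlip.
  (* The three errors have coefficients l^2, m^2 and l m, whereas (l + m)^2 contains 2 l m; one l m
     is left over. *)
  rewrite -subr_ge0 [X in 0 <= X](_ : _ = l * m * (w * v) * `|h| ^+ 2).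
    by rewrite !mulr_ge0 ?exprn_ge0.
  by ring.
- rewrite (_ : (l + m) * (w * v) = l * w * v + w * (m * v)); last by ring.
  apply: deriv_bounded_add; apply: IHk => //; rewrite ?mulr_ge0//.
    exact: le_trans (norm_bilin_left _ _) B1.
  exact: le_trans (norm_bilin_right _ _) B1.
Qed.

Lemma deriv_bounded_exp k (V : normedModType R) r n : 0 < r ->
  deriv_bounded k r (n%:R / r) (r ^+ n) (fun x : bop V V => x ^+ n).
Proof.
move=> r0; elim: n => [|n IHn].
  rewrite mul0r expr0.
  rewrite (_ : (fun x : bop V V => x ^+ 0) = (fun=> 1)); last first.
    by apply/funext => x; rewrite expr0.
  apply: deriv_bounded_const => //.
  exact: norm_bop_one.
rewrite -(_ : r^-1 + n%:R / r = n.+1%:R / r);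
  last by rewrite -nat1r mulrDl mul1r.
rewrite exprS.
rewrite (_ : (fun x => _) = (fun x : bop V V => comp_bop V V V x (x ^+ n)));
  last first.
  by apply/funext => x; rewrite exprS; apply: bop_eq.
apply: deriv_bounded_bilin => //.
- by apply: norm_bop_le => // x; rewrite mul1r; exact: norm_comp_bop.
- by rewrite invr_ge0 ltW.
- by rewrite divr_ge0// ltW.
- exact: ltW.
- by rewrite exprn_ge0// ltW.
- exact: deriv_bounded_id.
Qed.

End DominatedDerivatives.

Section SeriesSmooth.
Context {R : realType}.

Lemma series_cvg_norm_le (F : normedModType R) (u : nat -> F) (v : nat -> R)
    a (c : R) :
  series u @ \oo --> a -> (forall n, 0 <= v n) -> 0 <= c ->
  cvgn (series v) -> (forall n, `|u n| <= v n * c) ->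
  `|a| <= limn (series v) * c.
Proof.
move=> ua v0 c0 cv uv; apply: norm_cvg_le ua _ => n.
rewrite seriesEord; apply: le_trans (ler_norm_sum _ _ _) _.
apply: (@le_trans _ _ (series v n * c)).
  by rewrite seriesEord mulr_suml; apply: ler_sum => i _; exact: uv.
rewrite ler_wpM2r//; apply: nondecreasing_cvgn_le cv _.
by apply: nondecreasing_series => i _ _; exact: v0.
Qed.

Lemma series_cvgB (F : normedModType R) (u v : nat -> F) a b :
  series u @ \oo --> a -> series v @ \oo --> b ->
  series (fun n => u n - v n) @ \oo --> a - b.
Proof.
move=> ua vb; rewrite (_ : series _ = (fun n => series u n - series v n)).
  exact: cvgB.
by apply/funext => n; rewrite !seriesEord/= sumrB.
Qed.

(** One more order of domination is assumed than the class obtained: continuity of the sum uses the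
    Lipschitz bounds, summed by [j = 1], and differentiability the quadratic remainders, summed by
    [j = 2]. Passing to derivatives replaces [w] by [l * w] and shifts [j] by one, hence summability
    for every [j]. *)
Lemma Cn_on_series k (E : normedModType R) (F : completeNormedModType R) r
    (l w : nat -> R) (p : nat -> E -> F) :
  (forall n, 0 <= l n) -> (forall n, 0 <= w n) ->
  (forall j, cvgn (series (fun n => l n ^+ j * w n))) ->
  (forall n, deriv_bounded k.+1 r (l n) (w n) (p n)) ->
  Cn_on k [set x | `|x| < r] (fun x => limn (series (p ^~ x))).
Proof.
move=> l0.
have room x : `|x| < r -> exists2 d : R, 0 < d &
    forall h : E, `|h| < d -> `|x + h| < r.
  move=> xr; exists (r - `|x|); first by rewrite subr_gt0.
  by move=> h; rewrite ltrBrDl; exact: le_lt_trans (ler_normD _ _).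
have cp (G : completeNormedModType R) (q : nat -> E -> G) v m y :
    cvgn (series v) -> (forall n, deriv_bounded m r (l n) (v n) (q n)) ->
    `|y| < r -> series (q ^~ y) @ \oo --> limn (series (q ^~ y)).
  move=> cv qb yr; apply: (series_dom_cvg (v := v)) cv => n.
  exact: deriv_bounded_le (qb n) yr.
elim: k F w p => [|k IHk] F w p w0 lw pb.
  have cw : cvgn (series w) by have := lw 0%N; under eq_fun do rewrite mul1r.
  have cl : cvgn (series (fun n => l n * w n)).
    by have := lw 1%N; under eq_fun do rewrite expr1.
  move=> x xr; apply/continuousP_eps => e e0; have [d d0 dP] := room x xr.
  pose K := limn (series (fun n => l n * w n)).
  have K0 : 0 <= K.
    by apply: limr_ge cl _; near=> n; rewrite seriesEord sumr_ge0// => i _;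
      exact: mulr_ge0.
  have K1 : 0 < K + 1 by rewrite ltr_wpDl.
  exists (Num.min d (e / (K + 1))) => [|h].
    by rewrite lt_min d0 divr_gt0.
  rewrite lt_min => /andP[hd hK].
  have ser := series_cvgB (cp _ _ _ _ _ cw pb (dP h hd)) (cp _ _ _ _ _ cw pb
    xr).
  apply: le_trans (series_cvg_norm_le ser _ (normr_ge0 h) cl _) _ => [n|n|].
  - exact: mulr_ge0.
  - have [_ [Dn [lip _ _]]] := pb n; apply: le_trans (lip _ _ xr (dP h hd)) _.
    by rewrite addrAC subrr add0r.
  move: hK; rewrite ltr_pdivlMr// => /ltW; apply: le_trans.
  by rewrite mulrC ler_wpM2l// lerDl.
have /choice[Dp DpP] : forall n, exists Dn : E -> bop E F,
   [/\ forall x y, `|x| < r -> `|y| < r ->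
            `|p n y - p n x| <= l n * w n * `|y - x|,
          forall x y, `|x| < r -> `|y| < r ->
            `|p n y - p n x - Dn x (y - x)| <= l n ^+ 2 * w n * `|y - x| ^+ 2 &
          deriv_bounded k.+1 r (l n) (l n * w n) Dn].
  by move=> n; have [_ [Dn DnP]] := pb n; exists Dn.
exists (fun x => limn (series (Dp ^~ x))); split; last first.
  apply: (IHk _ (fun n => l n * w n)) => [n|j|n].
  - by rewrite mulr_ge0.
  - by under eq_fun do rewrite mulrA -exprSr; exact: lw.
  - by have [] := DpP n.
move=> x xr.
pose K := limn (series (fun n => l n ^+ 2 * w n)).
have cw : cvgn (series w) by have := lw 0%N; under eq_fun do rewrite mul1r.
have cD : series (Dp ^~ x) @ \oo --> limn (series (Dp ^~ x)).
  apply: (cp _ _ (fun n => l n * w n) k.+1) => // [|n].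
    by have := lw 1%N; under eq_fun do rewrite expr1.
  by have [] := DpP n.
have K0 : 0 <= K.
  apply: limr_ge (lw 2) _; near=> n; rewrite seriesEord sumr_ge0// => i _.
  by rewrite mulr_ge0// exprn_ge0.
have K1 : 0 < K + 1 by rewrite ltr_wpDl.
have [d d0 dP] := room x xr; apply/is_diffP => e e0.
exists (Num.min d (e / (K + 1))) => [|h].
  by rewrite lt_min d0 divr_gt0.
rewrite lt_min => /andP[hd hK].
have ser := series_cvgB (series_cvgB (cp _ _ _ _ _ cw pb (dP h hd))
  (cp _ _ _ _ _ cw pb xr)) (bop_series (eval_bop F h) cD).
have h2 : 0 <= `|h| ^+ 2 by rewrite exprn_ge0.
apply: le_trans (series_cvg_norm_le ser _ h2 (lw 2) _) _ => [n|n|].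
- by rewrite mulr_ge0// exprn_ge0.
- have [_ tay _] := DpP n; have := tay _ _ xr (dP h hd).
  by rewrite [x + h - x]addrAC subrr add0r.
rewrite expr2 mulrA ler_wpM2r//.
move: hK; rewrite ltr_pdivlMr// => /ltW; apply: le_trans.
by rewrite mulrC ler_wpM2l// lerDl.
Unshelve. all: by end_near. Qed.

(** A Bernoulli estimate: with t halfway between s and 1 and d = t - s, the expansion of (s + d)^n
    suggests n d s^n <= t^n, so C = 1/d works. *)
Lemma geometric_dominates_linear (s : R) : 0 <= s < 1 ->
  exists C t, [/\ 0 <= C, 0 <= t < 1 & forall n, n%:R * s ^+ n <= C * t ^+ n].
Proof.
move=> /andP[s0 s1]; pose t := (s + 1) / 2.
have [t0 t1 st] : [/\ 0 < t, t < 1 & s < t] by rewrite /t; split; lra.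
pose d := t - s; have d0 : 0 < d by rewrite subr_gt0.
have nd n : n%:R * d * s ^+ n <= t ^+ n.
  elim: n => [|n IHn]; first by rewrite !mul0r expr0.
  have sn : 0 <= s ^+ n by rewrite exprn_ge0.
  have snt : s ^+ n <= t ^+ n by rewrite lerXn2r ?nnegrE// ltW.
  rewrite !exprS -nat1r.
  have h1 : s * (n%:R * d * s ^+ n) <= s * t ^+ n by rewrite ler_wpM2l.
  have h2 : s * (d * s ^+ n) <= d * t ^+ n.
    rewrite mulrCA; apply: ler_wpM2l; first exact: ltW.
    apply: le_trans snt.
    by rewrite ler_piMl// ltW.
  rewrite (_ : t * t ^+ n = s * t ^+ n + d * t ^+ n); last by rewrite /d; ring.
  rewrite (_ : _ * _ * _ = s * (n%:R * d * s ^+ n) + s * (d * s ^+ n));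
    last by ring.
  exact: lerD.
exists d^-1, t; split=> [||n]; first by rewrite invr_ge0 ltW.
  by rewrite ltW.
by rewrite ler_pdivlMl// mulrA (mulrC d) nd.
Qed.

Lemma geometric_dominates_poly j (s : R) : 0 <= s < 1 ->
  exists C t, [/\ 0 <= C, 0 <= t < 1 & forall n,
    n%:R ^+ j * s ^+ n <= C * t ^+ n].
Proof.
elim: j s => [|j IHj] s s01.
  by exists 1, s; split=> // n; rewrite expr0.
have [C [t [C0 t01 Ct]]] := IHj s s01.
have [C' [t' [C'0 t'01 Ct']]] := geometric_dominates_linear t01.
exists (C * C'), t'; split=> // [|n]; first exact: mulr_ge0.
rewrite exprS -mulrA; apply: (@le_trans _ _ (n%:R * (C * t ^+ n))).
  by rewrite ler_wpM2l.
by rewrite mulrCA -mulrA ler_wpM2l.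
Qed.

Lemma Cn_on_power_series k (V : completeNormedModType R) (a : nat -> R)
    (r s C : R) :
  0 < r -> 0 <= s < 1 -> (forall n, `|a n| * r ^+ n <= C * s ^+ n) ->
  Cn_on k [set x : bop V V | `|x| < r]
    (fun x => limn (series (fun n => a n *: x ^+ n))).
Proof.
move=> r0 s01 aC.
have -> : (fun x : bop V V => limn (series (fun n => a n *: x ^+ n))) =
    (fun x => limn (series ((fun n (y : bop V V) => a n *: y ^+ n) ^~ x))) by
      [].
apply: (@Cn_on_series k (bop V V) (bop V V) r (fun n => n%:R / r)
  (fun n => `|a n| * r ^+ n)) => [n|n|j|n].
- by rewrite divr_ge0// ltW.
- by rewrite mulr_ge0// exprn_ge0// ltW.
- have [D [t [D0 /andP[t0 t1] Dt]]] := geometric_dominates_poly j s01.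
  have C0 : 0 <= C by have := aC 0%N; rewrite !expr0 !mulr1; apply: le_trans.
  apply: (series_dom_cvg (v := geometric (r^-1 ^+ j * C * D) t)) => [n|].
    rewrite /geometric/= ger0_norm; last first.
      by rewrite !mulr_ge0// ?exprn_ge0// ?divr_ge0// ltW.
    rewrite exprMn; apply: (@le_trans _ _ (n%:R ^+ j * r^-1 ^+ j * (C * s ^+
      n))).
      by rewrite ler_wpM2l// mulr_ge0// ?exprn_ge0// invr_ge0 ltW.
    rewrite (_ : _ * _ = r^-1 ^+ j * C * (n%:R ^+ j * s ^+ n)); last by ring.
    rewrite -[leRHS]mulrA ler_wpM2l// mulr_ge0// exprn_ge0// invr_ge0 ltW//.
  by apply: is_cvg_geometric_series; rewrite ger0_norm.
- by apply: deriv_bounded_scale; exact: deriv_bounded_exp.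
Qed.

Lemma Cn_on_opexp k (V : completeNormedModType R) :
  Cn_on k [set X : bop V V | `|X| < 1] (@opexp R V).
Proof.
(* These parameters amount to 2^n <= 2 n!. Radius 1 is all that the charts and the tangent curves
   use. *)
apply: (@Cn_on_power_series k V (fun n => (n`!%:R)^-1) 1 (1 / 2) 2) => [//||n].
  by apply/andP; split; lra.
rewrite expr1n mulr1 ger0_norm ?invr_ge0// expr_div_n expr1n mul1r.
rewrite ler_pdivlMr ?exprn_gt0// mulrC ler_pdivrMr ?ltr0n ?fact_gt0//.
elim: n => [|n IHn]; first by rewrite expr0 fact0; lra.
rewrite exprS factS natrM mulrCA; case: n IHn => [_|n IHn].
  by rewrite -[_`!]/1%N; lra.
by rewrite ler_pM// ler_nat.
Qed.

End SeriesSmooth.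

(** * The logarithm *)

Section Logarithm.
Context {R : realType}.

(** N equal steps change [f] by at most N (C / N^2) = C / N. This stands in for a vanishing
    derivative of a vector-valued function. *)
Lemma quadratic_increments_eq (F : normedModType R) (f : R -> F) (C : R) :
  (forall s t, 0 <= s <= 1 -> 0 <= t <= 1 ->
     `|f t - f s| <= C * (t - s) ^+ 2) -> f 1 = f 0.
Proof.
move=> fC; have C0 : 0 <= C.
  have := fC 0 1; rewrite subr0 expr1n mulr1 !lexx ler01 => /(_ isT isT).
  exact: le_trans.
have step N k : (k <= N.+1)%N -> `|f (k%:R / N.+1%:R) - f 0| <= k%:R * (C /
  N.+1%:R ^+ 2).
  elim: k => [|k IHk] kN; first by rewrite !mul0r subrr normr0.
  rewrite -(subrK (f (k%:R / N.+1%:R)) (f _)) -addrA.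
  apply: le_trans (ler_normD _ _) _.
  rewrite [leRHS](_ : _ = C / N.+1%:R ^+ 2 + k%:R * (C / N.+1%:R ^+ 2));
    last first.
    by rewrite -[k.+1%:R]nat1r mulrDl mul1r.
  apply: lerD; last exact/IHk/ltnW.
  have in01 i : (i <= N.+1)%N -> 0 <= (i%:R / N.+1%:R : R) <= 1.
    move=> iN; apply/andP; split; first exact: divr_ge0.
    by rewrite ler_pdivrMr// mul1r ler_nat.
  have := fC _ _ (in01 _ (ltnW kN)) (in01 _ kN).
  rewrite (_ : k.+1%:R / N.+1%:R - k%:R / N.+1%:R = 1 / N.+1%:R); last first.
    by rewrite -mulrBl -natr1 addrAC subrr add0r.
  by rewrite expr_div_n expr1n mul1r.
have : f 1 - f 0 = 0.
  apply/eqP; rewrite -normr_eq0 eq_le normr_ge0 andbT.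
  apply/ler_addgt0Pr => e e0; rewrite add0r.
  have Ce : 0 <= C / e by rewrite divr_ge0// ltW.
  have := archi_boundP Ce; set N := Num.bound _ => CN.
  have := step N N.+1 (leqnn _); rewrite divff// => /le_trans; apply.
  have N0 : 0 < N.+1%:R :> R by [].
  rewrite (_ : _ * _ = C / N.+1%:R); last by field; rewrite -nat1r in N0;
    rewrite nat1r.
  rewrite ler_pdivrMr// mulrC -ler_pdivrMr// ltW//.
  by apply: lt_trans CN _; rewrite ltr_nat.
by move/subr0_eq.
Qed.

(** The constant n^2 is uniform in s and t and polynomial in n, so it stays summable against the
    powers of [z]. The induction closes because n^2 + n <= (n + 1)^2. *)
Lemma expr_taylor (s t : R) n : 0 <= s <= 1 -> 0 <= t <= 1 ->
  `|t ^+ n - s ^+ n - n%:R * s ^+ n.-1 * (t - s)| <= n%:R ^+ 2 * (t - s) ^+ 2.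
Proof.
move=> /andP[s0 s1] /andP[t0 t1]; elim: n => [|n IHn].
  by rewrite !expr0 subrr !mul0r subrr normr0 mulr_ge0 ?sqr_ge0.
have ss : n%:R * s ^+ n.-1 * s = n%:R * s ^+ n.
  by case: n {IHn} => [|n]; rewrite ?mul0r// -mulrA -exprSr.
have -> : t ^+ n.+1 - s ^+ n.+1 - n.+1%:R * s ^+ n.+1.-1 * (t - s) =
    t * (t ^+ n - s ^+ n - n%:R * s ^+ n.-1 * (t - s)) +
    n%:R * s ^+ n.-1 * (t - s) ^+ 2.
  rewrite !exprS -nat1r /=.
  rewrite [RHS](_ : _ = t * t ^+ n - t * s ^+ n
     - n%:R * s ^+ n.-1 * s * (t - s)); last by ring.
  by rewrite ss; ring.
apply: le_trans (ler_normD _ _) _.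
have /andP[sn0 sn1] : 0 <= s ^+ n.-1 <= 1 by rewrite exprn_ge0// exprn_ile1.
have n0 : 0 <= n%:R :> R by [].
have d0 : 0 <= (t - s) ^+ 2 by rewrite sqr_ge0.
apply: (@le_trans _ _ (n%:R ^+ 2 * (t - s) ^+ 2 + n%:R * (t - s) ^+ 2)).
  apply: lerD.
    rewrite normrM (ger0_norm t0); apply: le_trans IHn.
    by rewrite ler_piMl.
  rewrite ger0_norm; last exact: mulr_ge0 (mulr_ge0 n0 sn0) d0.
  by rewrite ler_wpM2r// ler_piMr.
rewrite -nat1r; nra.
Qed.

Lemma zmod_cancel (Z : zmodType) (a b p q : Z) :
  b - p + (a - b + q - (q - p)) = a.
Proof.
have -> : a - b + q - (q - p) = a - (b - p).
  by rewrite !opprB -addrA [q + _]addrC subrK -addrA [- b + p]addrC.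
by rewrite addrC subrK.
Qed.

Context {V : completeNormedModType R}.
Implicit Types X Y z : bop V V.

(* For n = 0 the coefficient is 0, because division by 0 gives 0. *)
Definition log_coeff (n : nat) : R := (-1) ^+ n.+1 / n%:R.

Definition oplog1 z : bop V V := limn (series (fun n => log_coeff n *: z ^+ n)).

Lemma norm_log_coeff n : `|log_coeff n| <= 1.
Proof.
rewrite normrM normrX normrN1 expr1n mul1r normfV ger0_norm//.
by case: n => [|n]; rewrite ?invr0// invf_le1// ler1n.
Qed.

Lemma norm_log_term z n : `|z| < 1 / 2 ->
  `|log_coeff n *: z ^+ n| <= geometric 1 (1 / 2) n.
Proof.
move=> z2; rewrite normrZ /geometric/=; apply: ler_pM => //.
  exact: norm_log_coeff.
apply: le_trans (norm_bop_exp _ _) _; rewrite lerXn2r ?nnegrE//; exact: ltW.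
Qed.

Lemma cvg_geometric_half : series (geometric 1 (1 / 2 : R)) @ \oo --> (2 : R).
Proof.
rewrite [X in _ --> X](_ : 2 = 1 * (1 - 1 / 2)^-1); last by field.
by apply: cvg_geometric_series; rewrite ger0_norm; lra.
Qed.

Lemma oplog1_cvg z : `|z| < 1 / 2 ->
  series (fun n => log_coeff n *: z ^+ n) @ \oo --> oplog1 z.
Proof.
move=> z2; apply: (series_dom_cvg (v := geometric 1 (1 / 2))) => [n|].
  exact: norm_log_term.
exact/cvgP/cvg_geometric_half.
Qed.

Lemma norm_oplog1 z : `|z| < 1 / 2 -> `|oplog1 z| <= 2.
Proof.
move=> z2; rewrite -(cvg_lim (@Rhausdorff R) cvg_geometric_half).
apply: series_dom_lim => [n|]; first exact: norm_log_term.
exact/cvgP/cvg_geometric_half.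
Qed.

Lemma oplog1_comm z X : `|z| < 1 / 2 -> X * z = z * X ->
  X * oplog1 z = oplog1 z * X.
Proof.
move=> z2 Xz; rewrite -lmul_bopE -rmul_bopE.
rewrite !bop_series_lim; try exact/cvgP/oplog1_cvg.
congr (limn (series _)); apply/funext => n.
rewrite lmul_bopE rmul_bopE bop_scalerAl bop_scalerAr; congr (_ *: _).
exact/commrX.
Qed.

Lemma oplog1_0 : oplog1 0 = 0.
Proof.
rewrite /oplog1 (_ : (fun n => _) = (fun=> 0)).
  apply: cvg_lim => //; rewrite (_ : series _ = fun=> 0); first exact: cvg_cst.
  by apply/funext => n; rewrite seriesEord /= big1.
apply/funext => -[|n]; last by rewrite exprS mul0r scaler0.
by rewrite /log_coeff invr0 mulr0 scale0r.
Qed.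

Lemma Cn_on_oplog1 k : Cn_on k [set z : bop V V | `|z| < 1 / 2] oplog1.
Proof.
apply: (@Cn_on_power_series R k V log_coeff (1 / 2) (1 / 2) 1) => [||n].
- lra.
- by apply/andP; split; lra.
- by rewrite ler_wpM2r ?norm_log_coeff// exprn_ge0//; lra.
Qed.

Lemma norm_opexp X : `|opexp X| <= expR `|X|.
Proof.
apply: norm_cvg_le (@opexp_cvg _ _ X) _ => n.
apply: le_trans (series_exp_coeff_le n (normr_ge0 X)).
rewrite !seriesEord; apply: le_trans (ler_norm_sum _ _ _) _.
by apply: ler_sum => i _; exact: norm_expt.
Qed.

Section ExpLog.
Context (z : bop V V) (z2 : `|z| < 1 / 2).

(* The derivative of t |-> oplog1 (t *: z); it is z (1 + t z)^-1. *)
Let P (t : R) : bop V V :=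
  limn (series (fun n => (log_coeff n * n%:R * t ^+ n.-1) *: z ^+ n)).

Let norm_tz t : 0 <= t <= 1 -> `|t *: z| < 1 / 2.
Proof.
move=> /andP[t0 t1]; rewrite normrZ ger0_norm//; apply: le_lt_trans z2.
by rewrite ler_piMl.
Qed.

Let norm_P_term t n : 0 <= t <= 1 ->
  `|(log_coeff n * n%:R * t ^+ n.-1) *: z ^+ n| <= geometric 1 (1 / 2) n.
Proof.
move=> /andP[t0 t1]; rewrite normrZ /geometric/=; apply: ler_pM => //.
  have ln1 : `|log_coeff n * n%:R| <= 1.
    case: n => [|n]; first by rewrite mulr0 normr0.
    by rewrite /log_coeff divfK ?pnatr_eq0// normrX normrN1 expr1n.
  rewrite normrM -[leRHS]mulr1; apply: ler_pM => //.
  by rewrite normrX ger0_norm// exprn_ile1.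
apply: le_trans (norm_bop_exp _ _) _; rewrite lerXn2r ?nnegrE//; exact: ltW.
Qed.

Let P_cvg t : 0 <= t <= 1 ->
  series (fun n => (log_coeff n * n%:R * t ^+ n.-1) *: z ^+ n) @ \oo --> P t.
Proof.
move=> t01; apply: (series_dom_cvg (v := geometric 1 (1 / 2))) => [n|].
  exact: norm_P_term.
exact/cvgP/cvg_geometric_half.
Qed.

Let norm_P t : 0 <= t <= 1 -> `|P t| <= 2.
Proof.
move=> t01; rewrite -(cvg_lim (@Rhausdorff R) cvg_geometric_half).
apply: series_dom_lim => [n|]; first exact: norm_P_term.
exact/cvgP/cvg_geometric_half.
Qed.

Let P_mul t : 0 <= t <= 1 -> P t * (1 + t *: z) = z.
Proof.
move=> t01.
pose u n := (log_coeff n * n%:R * t ^+ n.-1) *: z ^+ n.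
have uS n : u n.+1 = ((-1) ^+ n * t ^+ n) *: z ^+ n.+1.
  rewrite /u /log_coeff divfK ?pnatr_eq0//; congr ((_ * _) *: _).
  by rewrite -addn2 exprD sqrrN expr1n mulr1.
have u0 : u 0 = 0 by rewrite /u mulr0 mul0r scale0r.
have tele n : series u n.+1 * (1 + t *: z) = z - ((-1) ^+ n * t ^+ n) *: z ^+
  n.+1.
  elim: n => [|n IHn].
    by rewrite seriesEord /= big_ord1 u0 mul0r !expr0 mulr1 scale1r expr1 subrr.
  rewrite (_ : series u n.+2 = series u n.+1 + u n.+1); last first.
    by rewrite !seriesEord /= big_ord_recr.
  rewrite mulrDl IHn uS mulrDr mulr1 addrA subrK.
  rewrite bop_scalerAr bop_scalerAl scalerA -exprSr; congr (_ + _).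
  by rewrite -scaleNr; congr (_ *: _); rewrite !exprS; ring.
have : (fun n => series u n.+1 * (1 + t *: z)) @ \oo --> P t * (1 + t *: z).
  apply: mul_bop_cvg; last exact: cvg_cst.
  by rewrite (cvg_shiftS (series u)); exact: P_cvg.
move=> /cvg_lim <- //; rewrite (funext tele); apply: cvg_lim => //.
rewrite -[X in _ --> X]subr0; apply: cvgB; first exact: cvg_cst.
rewrite -(funext uS) (cvg_shiftS u).
exact: (cvg_series_cvg_0 (cvgP _ (P_cvg t01))).
Qed.

Let K := limn (series (fun n : nat => n%:R ^+ 2 * (1 / 2 : R) ^+ n)).

Let K_cvg : cvgn (series (fun n : nat => n%:R ^+ 2 * (1 / 2 : R) ^+ n)).
Proof.
have [C [t [C0 /andP[t0 t1] Ct]]] : exists C t : R, [/\ 0 <= C, 0 <= t < 1 &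
    forall n : nat, n%:R ^+ 2 * (1 / 2) ^+ n <= C * t ^+ n].
  by apply: geometric_dominates_poly; apply/andP; split; lra.
apply: (series_dom_cvg (v := geometric C t)) => [n|].
  by rewrite ger0_norm// mulr_ge0// exprn_ge0//; lra.
by apply: is_cvg_geometric_series; rewrite ger0_norm.
Qed.

Let oplog1_taylor s t : 0 <= s <= 1 -> 0 <= t <= 1 ->
  `|oplog1 (t *: z) - oplog1 (s *: z) - (t - s) *: P s| <= K * (t - s) ^+ 2.
Proof.
move=> s01 t01; have d0 : 0 <= (t - s) ^+ 2 by rewrite sqr_ge0.
(* Multiplication by t - s is made a bounded operator so that [bop_series] can pass it through the
   sum. *)
pose T := (t - s) *: (1 : bop (bop V V) (bop V V)).
have := series_cvgB (series_cvgB (oplog1_cvg (norm_tz t01))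
  (oplog1_cvg (norm_tz s01))) (bop_series T (P_cvg s01)).
have TE X : T X = (t - s) *: X by rewrite /T bop_scaleE bop_oneE.
rewrite TE.
move=> ser; apply: series_cvg_norm_le ser _ d0 K_cvg _ => n.
  by rewrite mulr_ge0// exprn_ge0//; lra.
rewrite TE !bop_expZ !scalerA.
rewrite -!scalerBl normrZ.
rewrite (_ : _ - _ - _ = log_coeff n *
  (t ^+ n - s ^+ n - n%:R * s ^+ n.-1 * (t - s))); last by ring.
rewrite normrM [leRHS]mulrAC; apply: ler_pM => //; last first.
  apply: le_trans (norm_bop_exp _ _) _; rewrite lerXn2r ?nnegrE//; exact: ltW.
rewrite -[leRHS]mul1r; apply: ler_pM => //; first exact: norm_log_coeff.
exact: expr_taylor.
Qed.

Let oplog1_commz t : 0 <= t <= 1 -> z * oplog1 (t *: z) = oplog1 (t *: z) * z.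
Proof.
move=> t01; apply: oplog1_comm; first exact: norm_tz.
by rewrite bop_scalerAl bop_scalerAr.
Qed.

Let oplog1_commute s t : 0 <= s <= 1 -> 0 <= t <= 1 ->
  oplog1 (s *: z) * oplog1 (t *: z) = oplog1 (t *: z) * oplog1 (s *: z).
Proof.
move=> s01 t01; apply: oplog1_comm; first exact: norm_tz.
by rewrite bop_scalerAl bop_scalerAr oplog1_commz.
Qed.

(* U is constant, because its increments are O((t - s)^2). *)
Let U t : bop V V := opexp (- oplog1 (t *: z)) * (1 + t *: z).

(** By commutation, U t = exp(-Y) exp(W) (1 + t z), where Y is the logarithm at s and W is Y minus
    the logarithm at t. Up to second order, exp(W) is 1 - (t - s) P s, and P s (1 + s z) = z turns
    (1 - (t - s) P s) (1 + t z) into 1 + s z. *)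
Let U_quadratic : exists C : R, forall s t, 0 <= s <= 1 -> 0 <= t <= 1 ->
  `|U t - U s| <= C * (t - s) ^+ 2.
Proof.
have K0 : 0 <= K.
  apply: limr_ge K_cvg _; near=> n; rewrite seriesEord sumr_ge0// => i _.
pose M := (2 + K) ^+ 2 * expR (2 + K) + K.
(* [expR 2] bounds exp(-Y) since |Y| <= 2; the 1 is 2 (1/2), bounding P s z; [M] bounds the
   second-order part of exp(W), and the last 2 bounds 1 + t z. *)
exists (expR 2 * (1 + M * 2)) => s t s01 t01.
set d := t - s; pose Y := oplog1 (s *: z).
pose W := - (oplog1 (t *: z) - Y).
have d1 : `|d| <= 1 by rewrite ler_norml /d; move/andP: s01 => [];
  move/andP: t01 => []; lra.
pose E := opexp W - 1 - W; pose G := oplog1 (t *: z) - Y - d *: P s.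
have G_le : `|G| <= K * d ^+ 2 by exact: oplog1_taylor.
have d2 : d ^+ 2 = `|d| ^+ 2 by rewrite real_normK// num_real.
have W_le : `|W| <= (2 + K) * `|d|.
  rewrite normrN -(subrK (d *: P s) (_ - Y)) -/G addrC mulrDl.
  apply: le_trans (ler_normD _ _) _; apply: lerD.
    by rewrite normrZ mulrC ler_wpM2r// norm_P.
  apply: le_trans G_le _; rewrite d2 ler_wpM2l// expr2 ler_piMl//.
have W_le2 : `|W| <= 2 + K.
  by apply: le_trans W_le _; rewrite ler_piMr// addr_ge0.
have E_le : `|E| <= (2 + K) ^+ 2 * expR (2 + K) * d ^+ 2.
  apply: le_trans (opexp_taylor1 W) _.
  rewrite [leRHS]mulrAC; apply: ler_pM; rewrite ?exprn_ge0 ?expR_ge0//.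
    by rewrite d2 -exprMn lerXn2r ?nnegrE// mulr_ge0// addr_ge0.
  by rewrite ler_expR.
have EG_le : `|E - G| <= M * d ^+ 2.
  by apply: le_trans (ler_normB _ _) _; rewrite /M mulrDl lerD.
have eW : opexp (- oplog1 (t *: z)) = opexp (- Y) * opexp W.
  rewrite -opexpD; first by rewrite /W opprB addrA addNr add0r.
  by rewrite /W !mulrNN mulrBr mulrBl /Y oplog1_commute.
have oW : opexp W = 1 - d *: P s + (E - G).
  rewrite /E /G (_ : - W = oplog1 (t *: z) - Y); last by rewrite opprK.
  by rewrite zmod_cancel.
have Ut : U t = opexp (- Y) * ((1 - d *: P s + (E - G)) * (1 + t *: z)).
  by rewrite /U eW -oW mulrA.
have -> : U t - U s =
    opexp (- Y) * ((E - G) * (1 + t *: z) - d ^+ 2 *: (P s * z)).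
  rewrite Ut /U -/Y -mulrBr; congr (_ * _).
  have tz : 1 + t *: z = (1 + s *: z) + d *: z.
    by rewrite /d scalerBl -addrA [s *: z + _]addrC subrK.
  rewrite mulrDl (_ : (1 - d *: P s) * (1 + t *: z) =
      (1 + s *: z) - d ^+ 2 *: (P s * z)).
    by rewrite addrAC [_ - _ - (1 + _)]addrAC subrr add0r addrC.
  rewrite tz mulrBl mul1r bop_scalerAl mulrDr P_mul// bop_scalerAr scalerDr.
  by rewrite scalerA -expr2 opprD addrA addrK.
have zle : `|z| <= 1 by apply: ltW; apply: lt_trans z2 _; lra.
have tz_le : `|1 + t *: z| <= 2.
  apply: le_trans (ler_normD _ _) _; rewrite (_ : 2 = 1 + 1 :> R)//.
  apply: lerD; first exact: norm_bop_one.
  by apply: ltW; apply: lt_trans (norm_tz t01) _; lra.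
apply: le_trans (norm_bop_mul _ _) _; rewrite -mulrA; apply: ler_pM => //.
  apply: le_trans (norm_opexp _) _; rewrite ler_expR normrN.
  exact/norm_oplog1/norm_tz.
apply: le_trans (ler_normB _ _) _; rewrite addrC [leRHS]mulrDl [1 * _]mul1r;
  apply: lerD.
  rewrite normrZ ger0_norm ?sqr_ge0// ler_piMr ?sqr_ge0//.
  apply: le_trans (norm_bop_mul _ _) _.
  apply: (@le_trans _ _ (2 * (1 / 2))); last by lra.
  by apply: ler_pM => //; [exact: norm_P|exact: ltW].
apply: le_trans (norm_bop_mul _ _) _.
by rewrite mulrAC; apply: ler_pM.
Unshelve. all: by end_near. Qed.

Lemma opexp_oplog1 : opexp (oplog1 z) = 1 + z.
Proof.
have [C UC] := U_quadratic.
have := quadratic_increments_eq UC; rewrite /U !scale1r !scale0r oplog1_0.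
rewrite oppr0 opexp0 addr0 mulr1 => U1.
have := congr1 (fun X => opexp (oplog1 z) * X) U1.
by rewrite mulrA opexpN mul1r mulr1 => <-.
Qed.

End ExpLog.

(** Z = log(exp Y) commutes with Y and has the same exponential, so exp(Z - Y) = 1. As |Z - Y| <= 2
    + 1 <= 24/5, [opexp_fix_inj] applies to every vector. *)
Lemma oplog1_opexp Y : `|Y| < 1 -> `|opexp Y - 1| < 1 / 2 ->
  oplog1 (opexp Y - 1) = Y.
Proof.
move=> Y1 eY; set Z := oplog1 _.
have eZ : opexp Z = opexp Y by rewrite opexp_oplog1// addrC subrK.
have YZ : Y * Z = Z * Y.
  apply: oplog1_comm => //.
  by rewrite mulrBr mulrBl mulr1 mul1r opexp_comm.
have ZY1 : opexp (Z - Y) = 1.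
  by rewrite opexpD ?mulrN ?mulNr ?YZ// eZ opexpN.
apply: bop_eq => v; apply/eqP; rewrite -subr_eq0 -bop_subE; apply/eqP.
apply: opexp_fix_inj; last by rewrite ZY1.
apply: le_trans (ler_normB _ _) _; have := norm_oplog1 eY; rewrite -/Z.
by have := ltW Y1; lra.
Qed.

End Logarithm.

(** * The automorphism group *)

Section AutGroup.
Context {R : realType} {V : jbAlgebraType R}.
Implicit Types g h k : bop V V.

Lemma Aut_subgroup : GL_subgroup (Aut V).
Proof.
split=> [k []//||g h [gG gA] [hG hA]|k [kG kA]].
- by split; [exact: GL_one|].
- by split=> [|a b]; [exact: GL_mul|rewrite !bop_mulE hA gA].
- have [ki ik] := opinvP kG; split=> [|a b]; first exact: GL_opinv.
  have kiE x : k (opinv k x) = x by rewrite -bop_mulE ki.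
  have ikE x : opinv k (k x) = x by rewrite -bop_mulE ik.
  by rewrite -{1}[a]kiE -{1}[b]kiE -kA ikE.
Qed.

Lemma Lop_Aut k x : Aut V k -> Lop (k x) = k * Lop x * opinv k.
Proof.
move=> [kG kA]; have [ki _] := opinvP kG; apply: bop_eq => y.
rewrite !bop_mulE [RHS](_ : _ = k (jmul x (opinv k y)))// kA.
by rewrite -[k (opinv k y)]bop_mulE ki.
Qed.

Lemma Aut_Str : Aut V `<=` Str V.
Proof.
move=> k kA; have [kG kM] := kA; split=> //; exists (opinv k).
split=> [|x]; first exact: GL_opinv.
have [_ ik] := opinvP kG.
rewrite /Uop -kM !Lop_Aut// mulrBr mulrBl; congr (_ - _).
rewrite mulrnAr mulrnAl; congr (_ *+ 2); rewrite !expr2 !mulrA; congr (_ * _).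
by rewrite -(mulrA _ (opinv k)) ik mulr1.
Qed.

Definition fst_bop (E F : normedModType R) : bop (E * F)%type E.
Proof.
apply: (@mkbop _ _ _ (fst : E * F -> E)); split=> //.
by exists 1 => x; rewrite mul1r prod_normE /= le_max lexx.
Defined.

Definition snd_bop (E F : normedModType R) : bop (E * F)%type F.
Proof.
apply: (@mkbop _ _ _ (snd : E * F -> F)); split=> //.
by exists 1 => x; rewrite mul1r prod_normE /= le_max lexx orbT.
Defined.

Lemma continuous_polynomial_quadratic (E F : normedModType R) (T : bop E F)
    (B : bop E (bop E F)) : continuous_polynomial (fun x => T x + B x x).
Proof.
pose A (n : nat) : ('I_n -> E) -> F :=
  match n return ('I_n -> E) -> F with
  | 1%N => fun x => T (x ord0)
  | 2%N => fun x => B (x ord0) (x ord_max)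
  | _ => fun=> 0
  end.
exists 2%N, A; split=> [n|x]; last first.
  by rewrite !big_ord_recr big_ord0 /= !add0r.
case: n => [|[|[|n]]].
- split=> [x i a u v|]; first by rewrite scaler0 addr0.
  by exists 1 => x; rewrite normr0 mulr_ge0// prodr_ge0.
- split=> [x i a u v|]; first by rewrite ord1 /= linearP.
  by exists `|T| => x; rewrite big_ord1 norm_bop_apply.
- split=> [x i a u v|].
    rewrite /A; have [<-|i0] := eqVneq (ord0 : 'I_2) i.
      by rewrite !bopD !bopZ.
    have <- : ord_max = i.
      by apply/val_inj; case: i i0 => -[|[|m]] //= mlt; rewrite -val_eqE.
    by rewrite !bopD !bopZ.
  exists `|B| => x; rewrite big_ord_recl big_ord1.
  rewrite (_ : lift ord0 ord0 = ord_max) ?mulrA; last exact: val_inj.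
  exact: norm_bop_apply2.
- split=> [x i a u v|]; first by rewrite scaler0 addr0.
  by exists 1 => x; rewrite normr0 mulr_ge0// prodr_ge0.
Qed.

(** Multiplicativity is read as the operator equations g L_a = L_(g a) g, one for each [a]. Each is
    a linear plus a quadratic form in the first component of the pair (g, g^-1). *)
Lemma Aut_algebraic : algebraic_subgroup (Aut V).
Proof.
split; first exact: Aut_subgroup.
pose p (a : V) (gh : bop V V * bop V V) : bop V V :=
  gh.1 * Lop a - Lop (gh.1 a) * gh.1.
exists [set q | exists a, q = p a]; split=> [_ [a ->]|].
  pose S := fst_bop (bop V V) (bop V V).
  pose T := bcomp (rmul_bop (Lop a)) S.
  pose B := - bcomp (precomp_bop _ _ (bop V V) S)
    (bcomp (comp_bop V V V) (bcomp (@jmul_bop R V) (bcomp (eval_bop V a) S))).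
  rewrite (_ : p a = (fun x => T x + B x x)).
    exact: continuous_polynomial_quadratic.
  apply/funext => x; rewrite /p; congr (_ + _); rewrite /B !bop_oppE.
  by congr (- _); apply: bop_eq.
apply/seteqP; split=> [k [kG kA]|k [kG kp]].
  split=> // _ [a ->]; rewrite /p; apply/eqP; rewrite subr_eq0; apply/eqP.
  by apply: bop_eq => b; exact: kA.
split=> // a b; have /(congr1 (fun T : bop V V => T b)) := kp _ (ex_intro _ a
  erefl).
by rewrite /p bop_subE => /eqP; rewrite subr_eq0 => /eqP.
Qed.

Lemma closed_eq0 (E F : normedModType R) (f : E -> F) :
  continuous f -> closed [set x | f x = 0].
Proof.
move=> fc; have := @closed_comp _ _ f [set 0] (in1W fc).
by apply; exact: accessible_closed_set1 (hausdorff_accessible (@norm_hausdorff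
  _ _)) 0.
Qed.

Lemma Aut_closed : closure (Aut V) `&` GL V `<=` Aut V.
Proof.
move=> g [gA gG]; split=> // a b.
pose f k := jmul_bop (eval_bop V a k) (eval_bop V b k) +
  (- eval_bop V (jmul a b)) k.
have fc : continuous f.
  move=> k; have cB : {for k, continuous (fun k : bop V V =>
      jmul_bop (eval_bop V a k) (eval_bop V b k))}.
    by apply: continuous_bilin; exact: bop_continuous.
  exact: (continuousD cB (@bop_continuous _ _ _ (- eval_bop V (jmul a b)) k)).
have : closure [set k | f k = 0] g.
  apply: closure_subset gA => k [_ kA]; rewrite /= /f bop_oppE.
  by apply/eqP; rewrite subr_eq0; apply/eqP; rewrite [RHS]kA.
rewrite -(closure_id _).1; last exact: closed_eq0.
by rewrite /= /f bop_oppE => /eqP; rewrite subr_eq0 => /eqP/esym.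
Qed.

End AutGroup.

(** * The Banach space of derivations *)

Section Derivations.
Context {R : realType} {V : jbAlgebraType R}.

Definition der_pred : {pred bop V V} := fun D => `[< Der V D >].

(** Derivations form a type of their own because the slice charts require a complete normed space as
    model; the inclusion into B(V) is then an isometry. *)
Record derivation := Derivation {
  der_val :> bop V V;
  der_valP : der_val \in der_pred }.

HB.instance Definition _ := [isSub for der_val].
HB.instance Definition _ := [Choice of derivation by <:].

Lemma Der_zero : Der V 0.
Proof.
have jmul0 x : jmul x 0 = 0 by exact: (linear0 (Lop x)).
by move=> x y; rewrite !bop_zeroE jmul0 jmulC jmul0 addr0.
Qed.

Lemma Der_submod_closed : submod_closed der_pred.
Proof.
split=> [|a D D' /asboolP DD /asboolP DD']; apply/asboolP;
  first exact: Der_zero.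
move=> x y; rewrite !bop_addE !bop_scaleE DD DD' -!jmul_bopE.
by rewrite (bopD jmul_bop) (bopZ jmul_bop) bopD bopZ bop_addE bop_scaleE
  scalerDr addrACA.
Qed.

HB.instance Definition _ :=
  GRing.isSubmodClosed.Build R (bop V V) der_pred Der_submod_closed.
HB.instance Definition _ := [SubChoice_isSubLmodule of derivation by <:].

Definition der_norm (D : derivation) : R := `|der_val D|.

Lemma der_normD D D' : der_norm (D + D') <= der_norm D + der_norm D'.
Proof. exact: ler_normD. Qed.

Lemma der_normZ a D : der_norm (a *: D) = `|a| * der_norm D.
Proof. exact: normrZ. Qed.

Lemma der_norm_eq0 D : der_norm D = 0 -> D = 0.
Proof. by move=> /normr0_eq0 D0; apply/val_inj. Qed.

HB.instance Definition _ :=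
  @Lmodule_isNormed.Build R derivation der_norm der_normD der_normZ
    der_norm_eq0.

Lemma der_val_bounded : bounded_operator (der_val : derivation -> bop V V).
Proof. by split=> //; exists 1 => D; rewrite mul1r. Qed.

Definition der_incl : bop derivation (bop V V) := mkbop der_val_bounded.

Lemma norm_der_incl D : `|der_incl D| = `|D|.
Proof. by []. Qed.

Lemma range_der_incl X : range der_incl X <-> Der V X.
Proof.
split=> [[D _ <-]|DX]; first exact/asboolP/der_valP.
by exists (Derivation (introT (asboolP _) DX)).
Qed.

Lemma Der_closed : closed (Der V).
Proof.
move=> D DD x y.
pose T : bop (bop V V) V := bcomp (eval_bop V y) (bcomp jmul_bop (eval_bop V
  x)) +
  bcomp (jmul_bop x) (eval_bop V y) - eval_bop V (jmul x y).
have TE X : T X = jmul (X x) y + jmul x (X y) - X (jmul x y).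
  by rewrite /T bop_subE bop_addE.
have : closure [set X | T X = 0] D.
  apply: closure_subset DD => X DX; suff : T X = 0 by [].
  by rewrite TE; apply/eqP; rewrite subr_eq0; apply/eqP; rewrite DX.
rewrite -(closure_id _).1; last exact/closed_eq0/bop_continuous.
move=> TD; have {TD} : T D = 0 by [].
by rewrite TE => /eqP; rewrite subr_eq0 => /eqP/esym.
Qed.

Lemma derivation_complete (F : set_system derivation) :
  ProperFilter F -> cauchy F -> cvg F.
Proof.
move=> FF Fc.
have /cvg_ex[/= X FX] : cvg (der_incl D @[D --> F]).
  apply/cauchy_cvgP/cauchy_exP => e e0; have [D FD] := (cauchyP F).1 Fc e e0.
  exists (der_incl D).
  suff : F [set D' | ball (der_incl D) e (der_incl D')] by [].
  by apply: filterS FD => D'; rewrite -!ball_normE.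
have DX : Der V X.
  apply: (@closed_cvg _ _ F _ der_incl (Der V)) FX => //;
    first exact: Der_closed.
  by apply: nearW => D; apply/range_der_incl; exists D.
apply/cvg_ex; exists (Derivation (introT (asboolP _) DX)).
by move: FX => /cvgrPdist_le FX; apply/cvgrPdist_le.
Qed.

HB.instance Definition _ := Uniform_isComplete.Build derivation
  derivation_complete.

End Derivations.
Arguments derivation {R} V.

Section OpenPreimage.
Context {R : realType}.

Lemma open_preimage_on (E F : normedModType R) (U : set E) (W : set F)
    (f : E -> F) : open U -> open W -> (forall x, U x -> {for x,
      continuous f}) ->
  open [set x | U x /\ W (f x)].
Proof.
move=> Uo Wo fc; rewrite openE => x [Ux Wfx].
have Un : nbhs x U by exact: open_nbhs_nbhs.
have Wn : nbhs (f x) W by exact: open_nbhs_nbhs.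
exact: filterI Un (fc x Ux _ Wn).
Qed.

Lemma open_norm_lt (E : normedModType R) (r : R) : open [set x : E | `|x| < r].
Proof.
rewrite openE => x /= xr; apply/nbhs_ballP.
exists (r - `|x|); first by rewrite /= subr_gt0.
move=> y; rewrite -ball_normE /= ltrBrDl => yr; apply: le_lt_trans yr.
by rewrite -{1}[y](subrK x) addrC distrC ler_normD.
Qed.

Lemma Cn_on_addr n (E F : normedModType R) (U : set E) (f : E -> F) c :
  Cn_on n U f -> Cn_on n U (fun x => f x + c).
Proof. by move=> fC; apply: Cn_on_add fC _; exact: Cn_on_const. Qed.

End OpenPreimage.

(** * Logarithmic slice charts *)

Section Chart.
Context {R : realType} {V : jbAlgebraType R} (g : bop V V).
Context (gA : Aut V g).

Let gG : GL V g. Proof. by case: gA. Qed.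

(** [oplog1 z] stands for log(1 + z), so [oplog1 (shift x)] is log(g^-1 x). *)
Let shift (x : bop V V) : bop V V := opinv g * x - 1.

Let shift_Cn n U : Cn_on n U shift.
Proof.
apply: (Cn_on_addr (f := fun x : bop V V => opinv g * x)).
rewrite (_ : (fun x : bop V V => opinv g * x) = lmul_bop (opinv g)).
  exact: Cn_on_bop.
by apply/funext => x; rewrite lmul_bopE.
Qed.

(** The bound 1/2 makes exp(log) the identity; the bound 1 makes log(exp) the identity and stays
    below pi / 2. [chart_fun] exchanges the two conditions with those of [chart_cod]. *)
Definition chart_dom : set (bop V V) :=
  [set x | `|shift x| < 1 / 2 /\ `|oplog1 (shift x)| < 1].
Definition chart_cod : set (bop V V) :=
  [set Y | `|Y| < 1 /\ `|opexp Y - 1| < 1 / 2].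
Definition chart_fun (x : bop V V) : bop V V := oplog1 (shift x).
Definition chart_inv (Y : bop V V) : bop V V := g * opexp Y.

Let shift_dom : set (bop V V) := [set x | `|shift x| < 1 / 2].

Let shift_dom_open : open shift_dom.
Proof.
rewrite (_ : shift_dom = [set x | setT x /\ [set y | `|y| < 1 / 2] (shift x)]).
  apply: open_preimage_on; [exact: openT|exact: open_norm_lt|].
  by move=> x _; exact: (Cn_on_continuous (shift_Cn 0 setT)).
by apply/seteqP; split=> x //= [].
Qed.

Let chart_fun_Cn n : Cn_on n shift_dom chart_fun.
Proof. by apply: Cn_on_comp (shift_Cn n _) (Cn_on_oplog1 n). Qed.

Lemma chart_fun_smooth : smooth_on chart_dom chart_fun.
Proof.
split=> [|n]; last by apply: Cn_on_sub (chart_fun_Cn n) => x [].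
apply: (open_preimage_on (U := shift_dom) (W := [set Y | `|Y| < 1]));
  [exact: shift_dom_open|exact: open_norm_lt|].
by move=> x; exact: (Cn_on_continuous (chart_fun_Cn 0)).
Qed.

Lemma chart_inv_smooth : smooth_on chart_cod chart_inv.
Proof.
split=> [|n].
  apply: (open_preimage_on (U := [set Y : bop V V | `|Y| < 1])
    (W := [set X : bop V V | `|X - 1| < 1 / 2]) (f := @opexp R V)).
  - exact: open_norm_lt.
  - rewrite (_ : [set X : bop V V | `|X - 1| < 1 / 2] =
      [set X : bop V V | setT X /\ [set Z | `|Z| < 1 / 2] (X - 1)]).
      apply: open_preimage_on; [exact: openT|exact: open_norm_lt|].
      move=> x _; apply: (Cn_on_continuous (n := 0) (U := setT)) => //.
      apply: Cn_on_addr; exact: (Cn_on_bop _ _ (1 : bop (bop V V) (bop V V))).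
    by apply/seteqP; split=> x //= [].
  - by move=> x; exact: (Cn_on_continuous (Cn_on_opexp 0 V)).
rewrite (_ : chart_inv = (fun Y => lmul_bop g (opexp Y))); last first.
  by apply/funext => Y; rewrite lmul_bopE.
apply: (Cn_on_sub (W := [set Y : bop V V | `|Y| < 1])); first by move=> Y [].
by apply: (Cn_on_comp (W := setT)) (Cn_on_opexp n V) (Cn_on_bop _ _ _).
Qed.

Lemma shift_chart_inv Y : shift (chart_inv Y) = opexp Y - 1.
Proof. by rewrite /shift /chart_inv mulrA (opinvP gG).2 mul1r. Qed.

Lemma chart_funK x : chart_dom x -> chart_inv (chart_fun x) = x.
Proof.
move=> [x1 _]; rewrite /chart_inv /chart_fun (opexp_oplog1 x1) /shift.
by rewrite addrC subrK mulrA (opinvP gG).1 mul1r.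
Qed.

Lemma chart_invK Y : chart_cod Y -> chart_fun (chart_inv Y) = Y.
Proof. by move=> [Y1 Y2]; rewrite /chart_fun shift_chart_inv (oplog1_opexp Y1
  Y2). Qed.

Lemma chart_fun_dom x : chart_dom x -> chart_cod (chart_fun x).
Proof.
move=> [x1 x2]; split; first exact: x2.
rewrite /chart_fun (opexp_oplog1 x1) [1 + _]addrC addrK; exact: x1.
Qed.

Lemma chart_inv_cod Y : chart_cod Y -> chart_dom (chart_inv Y).
Proof.
move=> [Y1 Y2]; split; rewrite shift_chart_inv; first exact: Y2.
rewrite (oplog1_opexp Y1 Y2); exact: Y1.
Qed.

(** Here x = g exp(Y) with |Y| < 1 <= pi / 2, so membership of x in the group is membership of
    exp(Y), which at this size is equivalent to Y being a derivation. *)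
Lemma chart_slice x : chart_dom x -> (Aut V x <-> range (@der_incl R V)
  (chart_fun x)).
Proof.
move=> xd; have [_ x2] := xd; rewrite range_der_incl -{1}(chart_funK xd)
  /chart_inv.
have [_ _ AM AV] := @Aut_subgroup R V.
split=> [gx|Dx]; last exact: AM gA (Der_Aut_opexp Dx).
apply: Aut_opexp_Der; first by apply: lt_le_trans x2 _; exact: pihalf_ge1.
by have := AM _ _ (AV _ gA) gx; rewrite mulrA (opinvP gG).2 mul1r.
Qed.

Definition aut_chart : slice_chart (@der_incl R V) (Aut V) :=
  SliceChart chart_fun_smooth chart_inv_smooth chart_fun_dom chart_inv_cod
    chart_funK chart_invK chart_slice.

Lemma aut_chart_dom : sc_dom aut_chart g.
Proof.
have s0 : shift g = 0 by rewrite /shift (opinvP gG).2 subrr.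
by split; rewrite s0 ?oplog1_0 normr0; lra.
Qed.

End Chart.

(** * Smoothness of the group law in slice charts *)

Section GroupLaw.
Context {R : realType} {V : completeNormedModType R}.
Notation BV := (bop V V).
Context {M : completeNormedModType R} {j : bop M BV} {G : set BV}.
Context (jI : forall m, `|j m| = `|m|) (GG : GL_subgroup G).

Lemma sc_param_in (c : slice_chart j G) h : sc_cod c (j h) -> G (sc_param c h).
Proof.
move=> ch; apply/(sc_slice (sc_inv_cod ch)); by rewrite sc_invK.
Qed.

Lemma sc_coordE (c : slice_chart j G) x : sc_dom c x -> G x ->
  j (sc_coord c x) = sc_fun c x.
Proof.
move=> cx Gx; have /(sc_slice cx)[m _ jm] := Gx.
exact: (xgetPex 0 (ex_intro (fun h => j h = sc_fun c x) m jm)).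
Qed.

(** [p] will be a projection of [M * M] or the identity of [M], so that one lemma serves
    multiplication and inversion. *)
Lemma sc_param_Cn (E : normedModType R) n (c : slice_chart j G) (p : bop E M) :
  Cn_on n [set h | sc_cod c (j (p h))] (fun h => sc_param c (p h)).
Proof.
apply: (Cn_on_comp (W := sc_cod c) (f := bcomp j p)) => //.
  exact: Cn_on_bop.
by have [_ ] := sc_inv_smooth c; apply.
Qed.

Lemma sc_cod_open (E : normedModType R) (c : slice_chart j G) (p : bop E M) :
  open [set h | sc_cod c (j (p h))].
Proof.
rewrite (_ : [set h | _] = [set h | setT h /\ sc_cod c (bcomp j p h)]).
  apply: open_preimage_on; [exact: openT|by have [] := sc_inv_smooth c|].
  by move=> x _; exact: bop_continuous.
by apply/seteqP; split=> x //= [].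
Qed.

Lemma sc_coord_smooth (E : normedModType R) (U : set E) (f : E -> BV)
    (c : slice_chart j G) :
  open U -> (forall x, U x -> G (f x)) -> (forall n, Cn_on n U f) ->
  smooth_on [set x | U x /\ sc_dom c (f x)] (fun x => sc_coord c (f x)).
Proof.
move=> Uo UG fC; have [do_ dC] := sc_fun_smooth c.
have Wo : open [set x | U x /\ sc_dom c (f x)].
  by apply: open_preimage_on => // x; exact: (Cn_on_continuous (fC 0)).
split=> // n; apply: (Cn_on_lift (g := fun x => sc_fun c (f x)) jI) => //.
  by move=> x [Ux cx]; apply: sc_coordE => //; exact: UG.
apply: (Cn_on_comp (W := sc_dom c)) (dC n); first by move=> x [].
by apply: Cn_on_sub (fC n) => x [].
Qed.

(** The law must be smooth in arbitrary slice charts, not only logarithmic ones. Both operations are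
    smooth in the ambient algebra and preserve [G], and [sc_coord_smooth] transfers this to the
    coordinates. *)
Lemma sc_smooth_group_law : smooth_group_law j G.
Proof.
have [GGL _ GM GV] := GG; split=> [c1 c2 c3 mul|c1 c2 inv].
  pose U := [set h : M * M | sc_cod c1 (j h.1) /\ sc_cod c2 (j h.2)].
  rewrite (_ : [set h | _] = [set h | U h /\ sc_dom c3 (mul h)]); last first.
    by apply/seteqP; split=> h [] //; case.
  apply: sc_coord_smooth => [|h [h1 h2]|n].
  - have o1 := sc_cod_open c1 (fst_bop M M).
    have o2 := sc_cod_open c2 (snd_bop M M).
    by have := openI o1 o2.
  - by apply: GM; exact: sc_param_in.
  - rewrite (_ : mul = (fun h => comp_bop V V V (sc_param c1 (fst_bop M M h))
       (sc_param c2 (snd_bop M M h)))); last first.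
      by apply/funext => h; apply: bop_eq.
    apply: Cn_on_bilin.
      by apply: Cn_on_sub (sc_param_Cn n c1 (fst_bop M M)) => h [].
    by apply: Cn_on_sub (sc_param_Cn n c2 (snd_bop M M)) => h [].
apply: (sc_coord_smooth (U := [set h | sc_cod c1 (j h)])) => [|h hc|n].
- exact: (sc_cod_open c1 (1 : bop M M)).
- by apply: GV; exact: sc_param_in.
- apply: (Cn_on_comp (W := GL V)) (Cn_on_opinv n).
    by move=> h hc; apply: GGL; exact: sc_param_in.
  exact: (sc_param_Cn n c1 (1 : bop M M)).
Qed.

End GroupLaw.

(** * The Lie subgroup and its tangent space *)

Section Main.
Context {R : realType} {V : jbAlgebraType R}.

Lemma Aut_embedded : embedded_lie_subgroup (Aut V).
Proof.
split; [exact: Aut_subgroup|exact: Aut_closed|].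
exists (derivation V), der_incl; split.
- exact: norm_der_incl.
- by move=> g gA; exists (aut_chart gA); exact: aut_chart_dom.
- by apply: sc_smooth_group_law; [exact: norm_der_incl|exact: Aut_subgroup].
Qed.

Definition line (D : bop V V) : bop R^o (bop V V).
Proof.
apply: (@mkbop _ _ _ (fun t : R^o => (t : R) *: D)); split=> [a s t|].
  by rewrite scalerDl scalerA.
by exists `|D| => t; rewrite normrZ mulrC.
Defined.

Lemma opexp_line_diff D : is_diff (0 : R^o) (fun t => opexp (line D t)) (line
  D).
Proof.
apply/is_diffP => e e0.
pose c := `|D| ^+ 2 * expR `|D| + 1.
have c0 : 0 < c by rewrite ltr_wpDl// mulr_ge0 ?exprn_ge0 ?expR_ge0.
exists (Num.min 1 (e / c)) => [|h]; first by rewrite lt_min ltr01 divr_gt0.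
rewrite lt_min => /andP[h1 hc].
rewrite add0r (linear0 (line D)) opexp0.
apply: le_trans (opexp_taylor1 _) _.
have hD : `|line D h| = `|h| * `|D| by rewrite normrZ.
have hD1 : `|line D h| <= `|D| by rewrite hD ler_piMl// ltW.
apply: (@le_trans _ _ ((`|h| * `|D|) ^+ 2 * expR `|D|)).
  by rewrite hD ler_wpM2l ?exprn_ge0// ler_expR -hD.
rewrite (_ : _ * _ = `|h| * (`|D| ^+ 2 * expR `|D|) * `|h|); last by ring.
rewrite ler_wpM2r//; move: hc; rewrite ltr_pdivlMr// => /ltW; apply: le_trans.
by rewrite ler_wpM2l// lerDl.
Qed.

Lemma is_diff_is_derive (F : normedModType R) (f : R^o -> F) x (L : bop R^o F)
  H :
  is_diff x f L -> L 1 = H -> is_derive x (1 : R^o) f H.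
Proof.
move=> fL LH; have df := ex_diff (is_diff_def := fL).
apply: DeriveDef; first exact: diff_derivable.
by rewrite deriveE// (diff_val (is_diff_def := fL)).
Qed.

Lemma is_diff_derive_val (F : normedModType R) (f : R^o -> F) x (L : bop R^o F)
  H :
  is_diff x f L -> is_derive x (1 : R^o) f H -> L 1 = H.
Proof.
move=> fL fH; have df := ex_diff (is_diff_def := fL).
by rewrite -(derive_val (is_derive := fH)) deriveE// (diff_val (is_diff_def :=
  fL)).
Qed.

Lemma ball0E (E : normedModType R) (e : R) : ball (0 : E) e = [set x | `|x| <
  e].
Proof.
by apply/seteqP; split=> x; rewrite -ball_normE /= sub0r normrN.
Qed.

Lemma Der_tangent : Der V `<=` tangent_space (Aut V) 1.
Proof.
move=> D DD; have D1 : 0 < `|D| + 1 by rewrite ltr_wpDl.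
(* This interval keeps t D in the unit ball, where the exponential is known to be smooth. *)
exists (`|D| + 1)^-1; split; first by rewrite invr_gt0.
exists (fun t => opexp (line D t)); split.
- split=> [|n]; rewrite ball0E; first exact: open_norm_lt.
  apply: (Cn_on_comp (W := [set X : bop V V | `|X| < 1])) (Cn_on_bop _ _ _)
    (Cn_on_opexp n V) => t /= te.
  rewrite normrZ; apply: (@le_lt_trans _ _ (`|t| * (`|D| + 1))).
    by rewrite ler_wpM2l// lerDl.
  by rewrite -ltr_pdivlMr// mul1r.
- by move=> t _; apply: Der_Aut_opexp; exact: Der_scale.
- by rewrite (linear0 (line D)) opexp0.
- apply: is_diff_is_derive (opexp_line_diff D) _.
  exact: scale1r.
Qed.

(** Both sides of c(t)(a b) = (c(t) a)(c(t) b) are differentiated at 0, where c(0) = 1; uniqueness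
    of the differential gives the Leibniz rule. *)
Lemma tangent_Der : tangent_space (Aut V) 1 `<=` Der V.
Proof.
move=> H [e [e0 [c [[bo cC] cA c0 cH]]]] a b.
have U0 : ball (0 : R^o) e 0 by exact: ballxx.
have [Dc [cD _]] := cC 1%N; have cL := cD _ U0.
have LH := is_diff_derive_val cL cH.
have d1 := is_diff_comp_bop cL (is_diff_bop (eval_bop V (jmul a b)) (c 0)).
have da := is_diff_comp_bop cL (is_diff_bop (eval_bop V a) (c 0)).
have db := is_diff_comp_bop cL (is_diff_bop (eval_bop V b) (c 0)).
pose L := bilin_left R^o jmul_bop (bcomp (eval_bop V a) (Dc 0)) (eval_bop V b
  (c 0)) +
  bilin_right R^o jmul_bop (eval_bop V a (c 0)) (bcomp (eval_bop V b) (Dc 0)).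
have LE h : L h = jmul_bop (bcomp (eval_bop V a) (Dc 0) h) (eval_bop V b (c 0))
  +
  jmul_bop (eval_bop V a (c 0)) (bcomp (eval_bop V b) (Dc 0) h).
  by rewrite /L bop_addE.
have d2 := is_diff_bilin da db LE.
have d3 : is_diff (0 : R^o) (fun t => eval_bop V (jmul a b) (c t)) L.
  apply: is_diff_ext bo U0 _ d2 => t /cA[_ ctA].
  exact/esym/ctA.
have E : bcomp (eval_bop V (jmul a b)) (Dc 0) 1 = L 1.
  by rewrite -(diff_val (is_diff_def := d1)) (diff_val (is_diff_def := d3)).
have : Dc 0 1 (jmul a b) = jmul (Dc 0 1 a) b + jmul a (Dc 0 1 b).
  have := E; rewrite LE c0; exact.
by rewrite LH.
Qed.

End Main.

Theorem theorem3p17 (R : realType) (V : jbAlgebraType R) :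
  let B : set (bop V V) := [set X | `|X| < pi / 2%:R] in
  [/\ Aut V `<=` Str V,
      algebraic_subgroup (Aut V) &
      embedded_lie_subgroup (Aut V)] /\
  opexp @` (B `&` Lie (Aut V)) = (opexp @` B) `&` Aut V /\
  [/\ Lie (Aut V) = Der V,
      tangent_space (Aut V) 1 = Der V &
      Lie (Aut V) `<=` Lie (Str V)].
Proof.
move=> B; split; [split|split; [|split]].
- exact: Aut_Str.
- exact: Aut_algebraic.
- exact: Aut_embedded.
- exact: Aut_opexp_ball.
- exact: Lie_Aut.
- by apply/seteqP; split; [exact: tangent_Der|exact: Der_tangent].
- by move=> H HA t; exact/Aut_Str/HA.
Qed.
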